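(* Let $k$ be an algebraically closed field of arbitrary characteristic, let $n\ge 1$, and let $V\subset \mathbb{A}^n$ be an affine subvariety defined over $\overline{k(t)}$. For each real $\epsilon\ge 0$ let $S_\epsilon:=\{P\in\mathbb{A}^n(\overline{k(t)}) : h(P)\le\epsilon\}$. If for each $\epsilon>0$ the subset $V(\overline{k(t)})\cap S_\epsilon$ is Zariski dense in $V$, then $V$ is defined over $k$.
   Context: Here $t$ is an indeterminate and $\overline{k(t)}$ is a fixed algebraic closure of $k(t)$. Subvarieties of $\mathbb{A}^n$ are Zariski closed and not assumed irreducible. Height: the places $\Omega_{k(t)}$ of $k(t)$ are $v_\infty(f/g)=\deg g-\deg f$ and, for each $\alpha\in k$, $v_\alpha(f/g)=\mathrm{ord}_{t-\alpha}(f/g)$, for nonzero $f,g\in k[t]$. For a finite extension $K$ of $k(t)$, $\Omega_K$ is the set of all (inequivalent) places of $K$ lying above places of $k(t)$, each exponential valuation $w\in\Omega_K$ being normalized to have value group exactly $\mathbb{Z}$ on $K^*$ (so $w(x)=e(w\mid v)v(x)$ for $x\in k(t)^*$ and $w\mid v$, where $e(w\mid v)$ is the ramification index), with $w(0)=+\infty$. For $(x_1,\dots,x_n)\in\mathbb{A}^n(\overline{k(t)})$ with all $x_i$ in the finite extension $K$ of $k(t)$, $$h((x_1,\dots,x_n)):=\frac{1}{[K:k(t)]}\sum_{v\in\Omega_{k(t)}}\ \sum_{w\in\Omega_K,\ w\mid v}\max\{0,-w(x_1),\dots,-w(x_n)\}.$$ This does not depend on the choice of $K$. *)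

(* Defs.v *)
From mathcomp Require Import all_boot all_order all_algebra all_field.
From mathcomp Require Import boolp classical_sets constructive_ereal ereal.
From mathcomp Require Import reals esum.
(* Not imported: the notations of mpoly clash with those of analysis. *)
From mathcomp Require mpoly.

Set Implicit Arguments.
Unset Strict Implicit.
Unset Printing Implicit Defensive.

Import GRing.Theory Num.Theory.

Local Open Scope classical_set_scope.
Local Open Scope ring_scope.

Notation ratfun k := {fraction {poly k}}.

(* Exponential valuations take their values in \bar int = Z \cup {-oo, +oo};
   the value -oo is excluded by the second and third fields. *)
Record normalized_valuation (K : fieldType) (w : K -> \bar int) : Prop :=
  NormalizedValuation {
    valuation0 : w 0 = +oo%E;
    valuation_group : w @` [set x | x != 0] = range EFin;
    valuationM : forall x y, w (x * y) = (w x + w y)%E;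
    valuationD : forall x y, (Order.min (w x) (w y) <= w (x + y)%R)%E
  }.

Section RationalFunctionField.
Variable k : fieldType.

(* \n_(repr x) / \d_(repr x) is some representation of x as a fraction f / g;
   the values below do not depend on it.  Since size f = deg f + 1 for f != 0,
   size g - size f is deg g - deg f. *)
Definition v_infty (x : ratfun k) : \bar int :=
  if x == 0 then +oo%E
  else ((size \d_(repr x))%:Z - (size \n_(repr x))%:Z)%:E.

Definition v_at (a : k) (x : ratfun k) : \bar int :=
  if x == 0 then +oo%E
  else ((mup a \n_(repr x))%:Z - (mup a \d_(repr x))%:Z)%:E.

Definition ratfun_places : set (ratfun k -> \bar int) :=
  [set v | v = v_infty \/ exists a : k, v = v_at a].

End RationalFunctionField.

Section Height.
Variables (k : fieldType) (R : realType).

Section FixedExtension.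
Variable K : fieldExtType (ratfun k).

(* The number e is the ramification index e(w | v). *)
Definition lies_above (w : K -> \bar int) (v : ratfun k -> \bar int) : Prop :=
  exists2 e : nat, (0 < e)%N & forall a : ratfun k, w a%:A = (e%:Z%:E * v a)%E.

(* A normalized valuation is determined by its equivalence class, so places of
   K are represented by their normalized valuations. *)
Definition places : set (K -> \bar int) :=
  [set w | normalized_valuation w /\
           exists2 v, ratfun_places v & lies_above w v].

(* max {0, - w (x_1), ..., - w (x_n)}; the maximum is never infinite, because
   - w (x_i) is -oo when x_i = 0 and an integer otherwise. *)
Definition local_height n (w : K -> \bar int) (x : 'I_n -> K) : int :=
  fine (\big[Order.max/0%E]_(i < n) (- w (x i))%E).

Definition height_in n (x : 'I_n -> K) : \bar R :=
  (((\dim {:K})%:R^-1)%:E *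
   \esum_(v in @ratfun_places k)
     \esum_(w in places `&` [set w | lies_above w v])
       ((local_height w x)%:~R)%:E)%E.

End FixedExtension.

Variables (L : fieldType) (iota : {rmorphism ratfun k -> L}).

Definition is_height n (P : 'I_n -> L) (r : \bar R) : Prop :=
  exists (K : fieldExtType (ratfun k)) (j : {rmorphism K -> L})
         (x : 'I_n -> K),
    [/\ forall a : ratfun k, j a%:A = iota a,
        forall i, j (x i) = P i &
        r = height_in x].

(* The coordinates of P lie in some K and the height does not depend on the
   choice of K when L is algebraic over k(t), so the default value +oo is then
   not used. *)
Definition height n (P : 'I_n -> L) : \bar R :=
  xget +oo%E [set r | is_height P r].

Definition small_points n (eps : R) : set ('I_n -> L) :=
  [set P | (height P <= eps%:E)%E].

End Height.

Section Zariski.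
Variables (L : fieldType) (n : nat).

Definition zero_locus (S : set (mpoly.mpoly n L)) : set ('I_n -> L) :=
  [set P | forall p, S p -> mpoly.meval P p = 0].

Definition zariski_closed (V : set ('I_n -> L)) : Prop :=
  exists S, V = zero_locus S.

Definition zariski_dense_in (V A : set ('I_n -> L)) : Prop :=
  A `<=` V /\ forall Z, zariski_closed Z -> A `<=` Z -> V `<=` Z.

Definition defined_over (F : fieldType) (phi : {rmorphism F -> L})
    (V : set ('I_n -> L)) : Prop :=
  exists S : set (mpoly.mpoly n F), V = zero_locus (mpoly.map_mpoly phi @` S).

End Zariski.

Section ConstantEmbedding.
Variables (k L : fieldType) (iota : {rmorphism ratfun k -> L}).

Definition const_embedding : {rmorphism k -> L} :=
  iota \o (@tofrac {poly k} \o polyC).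

End ConstantEmbedding.

(* Main.v *)
Require Import Defs.
From HB Require Import structures.
From mathcomp Require Import all_boot all_order all_algebra all_field.
From mathcomp Require Import boolp classical_sets constructive_ereal ereal.
From mathcomp Require Import fsbigop cardinality reals esum.
From mathcomp Require mpoly.
From mathcomp Require Import zify ring.

(** The coefficients of a polynomial [f] that vanishes on [V] span a finite
dimensional space over [k]; so [f = sum_j c_j F_j], where the [F_j] have
coefficients in [k] and the [c_j] are linearly independent over [k]. The main
point is that all [F_j] vanish at the zeros [P] of [f] of sufficiently small
height ([small_linear_relation]). By density they then vanish on [V], and [V] is
the set of common zeros of the polynomials over [k] that vanish on it.

To see that point, put [y_j = F_j(P)], so that [sum_j c_j y_j = 0]. The [c_j]
are algebraic over [k(t)] and act on a finite dimensional space over [k(t)] by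
matrices [B_j], with entries in [k[t]] after clearing denominators. The relation
implies [det (sum_j y_j B_j) = 0]. This is an algebraic equation for [t] whose
coefficients are forms in the [y_j] over [k], of a degree that depends on [f]
alone. It is not trivial unless all [y_j] vanish ([norm_poly_neq0]): modulo a
place the [y_j] become constants up to a common factor, and a combination of the
[B_j] with constant coefficients, not all zero, is multiplication by a nonzero
element. Determinants take the place of products over conjugates, which covers
inseparable extensions as well.

So [t] is a root of a nonzero polynomial whose coefficients have few poles,
namely at most a constant times [N h(P)] of them, where [N] is the degree over
[k(t)] of a field [K] that contains the coordinates of [P]. But if [t] is a root
of a polynomial whose coefficients have their poles bounded by a divisor [D], then
[N <= deg D] ([degree_le_of_root]), because [t] has [N] poles. This bounds [h(P)]
from below. The inequality follows from Riemann's inequality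
[dim L(D) <= deg D + 1] ([dim_bounded_by]) by counting dimensions.

Riemann's inequality rests on two facts: the residue field of each place is [k]
([residue]), and a function without poles is constant ([exists_pole]). For the
second, a subring of [K] that contains [k] and [1/z], but not [z], and is maximal
with these properties is a valuation ring by the classical argument. Its value
group contains that of [k(t)] with index at most [N], hence is discrete; and on
[k(t)] it induces one of the valuations at a point of [k] or at infinity. *)

Set Implicit Arguments.
Unset Strict Implicit.
Unset Printing Implicit Defensive.
Import Order.TTheory GRing.Theory Num.Theory.
Local Open Scope classical_set_scope.
Local Open Scope quotient_scope.
Local Open Scope ring_scope.
Local Notation "x %:F" := (tofrac x) : ring_scope.

(** * Linear algebra *)

Lemma linear_relation (F : fieldType) (I J : finType) (C : I -> J -> F) :
  (#|J| < #|I|)%N ->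
  exists2 v : I -> F, exists i, v i != 0 & forall j, \sum_i v i * C i j = 0.
Proof.
move=> JI; pose M : 'M_(#|I|, #|J|) := \matrix_(a, b) C (enum_val a) (enum_val b).
have /rowV0Pn[v /sub_kermxP vM v0] : kermx M != 0.
  by rewrite kermx_eq0 -row_leq_rank -ltnNge (leq_ltn_trans (rank_leq_col M)).
exists (fun i => v 0 (enum_rank i)).
  by have /rV0Pn[a va] := v0; exists (enum_val a); rewrite enum_valK.
move=> j; move/matrixP/(_ 0 (enum_rank j)): vM; rewrite [RHS]mxE => vM.
rewrite -[RHS]vM mxE (reindex _ (onW_bij _ (enum_val_bij I))) /=.
by apply: eq_bigr => a _; rewrite !mxE enum_valK enum_rankK.
Qed.

(** * Rational functions *)

Section RatFun.
Variable k : fieldType.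
Implicit Type x : ratfun k.

Lemma numden_neq0 x : \d_(repr x) != 0.
Proof. exact: denom_ratioP. Qed.

Lemma numdenE x : x = (\n_(repr x))%:F / (\d_(repr x))%:F.
Proof.
apply: (canRL (mulfK _)); first by rewrite tofrac_eq0 numden_neq0.
suff e (y : {ratio {poly k}}) : \pi_(ratfun k) y * (\d_y)%:F = (\n_y)%:F.
  by rewrite -{1}[x]reprK e.
rewrite !piE; apply/eqmodP; rewrite /= FracField.equivfE.
rewrite /FracField.mulf !numden_Ratio ?mulf_neq0 ?oner_eq0 ?denom_ratioP //.
by rewrite !mulr1 mulrC.
Qed.

Lemma common_denominator (I : finType) (f : I -> ratfun k) :
  exists2 q : {poly k}, q != 0 & exists g : I -> {poly k}, forall i, q%:F * f i = (g i)%:F.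
Proof.
exists (\prod_i \d_(repr (f i))); first by apply/prodf_neq0 => i _; apply: numden_neq0.
exists (fun i => \n_(repr (f i)) * \prod_(l | l != i) \d_(repr (f l))) => i.
rewrite (bigD1 i) //= {2}(numdenE (f i)) !tofracM.
by rewrite mulrAC [_ * (_ / _)]mulrC divfK // tofrac_eq0 numden_neq0.
Qed.

End RatFun.

(** * Finite extensions of k(t) *)

Section FiniteExtension.
Variables (k : fieldType) (K : fieldExtType (ratfun k)).

Definition poly_in (p : {poly k}) : K := p%:F%:A.
HB.instance Definition _ := GRing.RMorphism.copy poly_in (in_alg K \o @tofrac {poly k}).

Definition const_in (c : k) : K := poly_in c%:P.
HB.instance Definition _ := GRing.RMorphism.copy const_in (poly_in \o polyC).

Definition tvar : K := poly_in 'X.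

Lemma poly_inE p : poly_in p = (map_poly const_in p).[tvar].
Proof.
rewrite -{1}[p]coefK poly_def rmorph_sum horner_poly; apply: eq_bigr => i _.
by rewrite -mul_polyC rmorphM rmorphXn.
Qed.

Lemma poly_in_eq0 p : (poly_in p == 0) = (p == 0).
Proof. by rewrite [LHS](fmorph_eq0 (in_alg K)) tofrac_eq0. Qed.

Local Notation N := (\dim {:K}).
Local Notation e := (vbasis {:K}).

Lemma polynomial_coords (I : finType) (f : I -> K) :
  exists2 q : {poly k}, q != 0 & exists g : I -> 'I_N -> {poly k},
    forall i, poly_in q * f i = \sum_l poly_in (g i l) * e`_l.
Proof.
have [q q0 [g gE]] := common_denominator (fun il : I * 'I_N => coord e il.2 (f il.1)).
exists q => //; exists (fun i l => g (i, l)) => i.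
rewrite {1}(coord_vbasis (memvf (f i))) mulr_sumr; apply: eq_bigr => l _.
by rewrite /poly_in !mulr_algl scalerA (gE (i, l)).
Qed.

(** These [k]-subspaces of [K] have dimension at most [s * N], and the union of
all of them is stable under any multiplication whose denominators have been
cleared. *)
Let lattice s x :=
  exists2 v : 'I_N -> {poly k}, forall l, (size (v l) <= s)%N &
    x = \sum_l poly_in (v l) * e`_l.

Let lattice_mul (a : K) : exists2 q : {poly k}, q != 0 & exists D, forall s x, lattice s x ->
  lattice (s + D) (poly_in q * x) /\ lattice (s + D) (poly_in q * a * x).
Proof.
have [q q0 [g gE]] := polynomial_coords (fun i : 'I_N => a * e`_i).
exists q => //; exists (maxn (size q) (\max_i \max_l size (g i l))).
move=> s x [v vs ->]; split.
  exists (fun l => q * v l) => [l|].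
    by rewrite (leq_trans (size_polyMleq _ _))//; have := vs l; lia.
  by rewrite mulr_sumr; apply: eq_bigr => l _; rewrite rmorphM mulrA.
exists (fun l => \sum_i v i * g i l) => [l|].
  rewrite (leq_trans (size_sum _ _ _))//; apply/bigmax_leqP => i _.
  rewrite (leq_trans (size_polyMleq _ _))//.
  have h : (size (g i l) <= \max_i \max_l size (g i l))%N.
    by apply: leq_trans (leq_bigmax i); apply: leq_trans (leq_bigmax l).
  have := vs i; lia.
rewrite mulr_sumr.
under eq_bigr => i _ do rewrite -mulrA [a * _]mulrCA (mulrCA (poly_in q)) gE mulr_sumr.
rewrite exchange_big /=; apply: eq_bigr => l _.
by rewrite rmorph_sum mulr_suml; apply: eq_bigr => i _; rewrite rmorphM mulrA.
Qed.

Let lattice_pow (a : K) : exists2 q : {poly k}, q != 0 & exists D, forall r i s x,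
  (i <= r)%N -> lattice s x -> lattice (s + r * D) (poly_in q ^+ r * a ^+ i * x).
Proof.
have [q q0 [D lD]] := lattice_mul a; exists q => //; exists D.
elim=> [|r IH] i s x.
  by rewrite leqn0 => /eqP->; rewrite !expr0 !mul1r mul0n addn0.
case: i => [_ lx|i ir lx].
  have [+ _] := lD _ _ (IH 0%N s x isT lx).
  by rewrite -addnA -mulSnr !mulrA -exprS.
have [_ +] := lD _ _ (IH i s x ir lx).
by rewrite -addnA -mulSnr !exprS !mulrA -(mulrA _ a) (mulrC a) !mulrA.
Qed.

(** The transcendence degree of [K] over [k] is one, by a dimension count: with
denominators cleared, the [r^2] products [a^i b^j] lie in a space of dimension
linear in [r]. *)
Lemma algebraic_dependence (a b : K) :
  exists r, exists2 u : 'I_r -> 'I_r -> k, exists i j, u i j != 0 &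
    \sum_i \sum_j const_in (u i j) * a ^+ i * b ^+ j = 0.
Proof.
have [qa qa0 [Da la]] := lattice_pow a; have [qb qb0 [Db lb]] := lattice_pow b.
have [q q0 [g gE]] := polynomial_coords (fun _ : unit => 1 : K).
pose s := \max_l size (g tt l); pose D := (s + (Da + Db))%N.
pose r := (N * D).+1.
have l1 (ij : 'I_r * 'I_r) :
    lattice (r * D) (poly_in (q * qa ^+ r * qb ^+ r) * (a ^+ ij.1 * b ^+ ij.2)).
  case: ij => i j /=.
  have lq : lattice s (poly_in q).
    exists (g tt); first by move=> l; apply: leq_bigmax.
    by rewrite -(gE tt) mulr1.
  have [v vs xE] := lb r j _ _ (ltnW (ltn_ord j)) (la r i _ _ (ltnW (ltn_ord i)) lq).
  exists v.
    move=> l; apply: leq_trans (vs l) _.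
    by rewrite /D !mulnDr -addnA leq_add2r leq_pmull.
  have regroup (c1 c2 c3 y z : K) : c1 * c2 * c3 * (y * z) = c3 * z * (c2 * y * c1) by ring.
  by rewrite -xE !rmorphM !rmorphXn regroup.
pose v ij := projT1 (cid2 (l1 ij)).
have vs ij l : (size (v ij l) <= r * D)%N by rewrite /v; case: cid2.
have vE (ij : 'I_r * 'I_r) : poly_in (q * qa ^+ r * qb ^+ r) * (a ^+ ij.1 * b ^+ ij.2) =
   \sum_l poly_in (v ij l) * e`_l by rewrite /v; case: cid2.
have [|u [[i j] uij] uE] := @linear_relation k ('I_r * 'I_r)%type ('I_N * 'I_(r * D))%type
    (fun ij lm => (v ij lm.1)`_lm.2).
  by rewrite !card_prod !card_ord mulnCA ltn_pmul2l.
exists r, (fun i j => u (i, j)); first by exists i, j.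
have z0 : poly_in (q * qa ^+ r * qb ^+ r) != 0.
  by rewrite poly_in_eq0 !mulf_neq0 ?expf_neq0.
set c := poly_in _ in vE z0.
apply: (mulfI z0); rewrite mulr0 pair_big /= mulr_sumr.
under eq_bigr => ij _ do rewrite -surjective_pairing -mulrA (mulrCA c) vE mulr_sumr.
rewrite exchange_big big1 //= => l _.
under eq_bigr => ij _ do rewrite mulrA /const_in -rmorphM.
rewrite -mulr_suml -rmorph_sum.
suff -> : \sum_ij (u ij)%:P * v ij l = 0 by rewrite rmorph0 mul0r.
apply/polyP => m; rewrite coef0 coef_sum.
under eq_bigr => ij _ do rewrite coefCM.
have [mD|mD] := ltnP m (r * D); first exact: (uE (l, Ordinal mD)).
by rewrite big1 // => ij _; rewrite nth_default ?mulr0 // (leq_trans (vs ij l)).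
Qed.

End FiniteExtension.

Section Constants.
Variables (k : closedFieldType) (K : fieldExtType (ratfun k)).

Lemma closed_factors (p : {poly k}) : p != 0 ->
  exists2 s : seq k, size s = (size p).-1 &
    p = lead_coef p *: \prod_(c <- s) ('X - c%:P).
Proof.
by move=> p0; have [s ps] := closed_field_poly_normal p; exists s;
  rewrite // [in RHS]ps size_scale ?lead_coef_eq0 // size_prod_XsubC.
Qed.

(** A polynomial over [k] is a product of linear factors, none of which vanishes
at [z]. *)
Lemma transcendental (z : K) (p : {poly k}) : (forall c, z != const_in K c) ->
  p != 0 -> (map_poly (const_in K) p).[z] != 0.
Proof.
move=> zc p0; have [s _ ->] := closed_factors p0.
rewrite map_polyZ hornerZ mulf_neq0 ?fmorph_eq0 ?lead_coef_eq0 //.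
rewrite rmorph_prod horner_prod prodf_seq_neq0; apply/allP => c _ /=.
by rewrite rmorphB /= map_polyX map_polyC hornerXsubC subr_eq0 zc.
Qed.

(** Read as a polynomial in [b], an algebraic relation between [z] and [b] is
nonzero because [z] is transcendental. *)
Lemma algebraic_over_transcendental (z b : K) : (forall c, z != const_in K c) ->
  exists2 F : {poly {poly k}}, F != 0 &
    (map_poly (fun p => (map_poly (const_in K) p).[z]) F).[b] = 0.
Proof.
move=> zc; have [r [u [i0 [j0 uij]] uE]] := algebraic_dependence z b.
pose P (j : 'I_r) : {poly k} := \sum_i u i j *: 'X^i.
have Pc (i j : 'I_r) : (P j)`_i = u i j.
  rewrite coef_sum (bigD1 i) //= big1 ?addr0 ?coefZ ?coefXn ?eqxx ?mulr1 //.
  by move=> l li; rewrite coefZ coefXn eq_sym (inj_eq val_inj) (negPf li) mulr0.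
exists (\sum_j P j *: 'X^j).
  apply/eqP => /(congr1 (fun F : {poly {poly k}} => F`_j0));
    rewrite coef0 coef_sum (bigD1 j0) //= big1.
    rewrite coefZ coefXn eqxx mulr1 addr0 => /(congr1 (fun F : {poly k} => F`_i0)) /eqP.
    by rewrite Pc coef0 (negPf uij).
  by move=> l li; rewrite coefZ coefXn eq_sym (inj_eq val_inj) (negPf li) mulr0.
pose ev : {rmorphism {poly k} -> K} := horner_eval z \o map_poly (const_in K).
rewrite -[map_poly _ _]/(map_poly ev _) rmorph_sum horner_sum -[RHS]uE exchange_big /=.
apply: eq_bigr => j _; rewrite map_polyZ map_polyXn hornerZ hornerXn /ev /= /horner_eval.
rewrite rmorph_sum horner_sum mulr_suml; apply: eq_bigr => i _ /=.
by rewrite map_polyZ map_polyXn hornerZ hornerXn.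
Qed.

End Constants.

(** * Valuations *)

(** Lower bounds for [w x], unlike values, behave in the same way when sums or
products vanish, so that [x = 0] needs no separate treatment. *)
Definition val_ge (K : fieldType) (w : K -> \bar int) (m : int) (x : K) : Prop :=
  (m%:E <= w x)%E.

Section Valuation.
Variables (K : fieldType) (w : K -> \bar int) (hw : normalized_valuation w).

Lemma val_fin x : x != 0 -> exists m : int, w x = m%:E.
Proof.
move=> x0; have : (w @` [set x | x != 0]) (w x) by exists x.
by rewrite (valuation_group hw) => -[m _ <-]; exists m.
Qed.

Lemma uniformizer : exists2 p, p != 0 & w p = 1%:E.
Proof.
have : range (@EFin int) 1%:E by exists 1.
by rewrite -(valuation_group hw) => -[p p0 wp]; exists p.
Qed.

Lemma val1 : w 1 = 0%E.
Proof.
have [m wm] := val_fin (oner_neq0 K); have := valuationM hw 1 1.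
by rewrite mulr1 wm -EFinD => -[/eqP]; rewrite -subr_eq subrr => /eqP <-.
Qed.

Lemma valX x n (m : int) : w x = m%:E -> w (x ^+ n) = (m *+ n)%:E.
Proof.
move=> wx; elim: n => [|n IH]; first by rewrite expr0 val1.
by rewrite exprS (valuationM hw) wx IH -EFinD mulrS.
Qed.

Lemma valV x (m : int) : x != 0 -> w x = m%:E -> w x^-1 = (- m)%:E.
Proof.
move=> x0 wx; have [n wn] := val_fin (invr_neq0 x0).
have := valuationM hw x x^-1; rewrite divff // val1 wx wn -EFinD => -[] /esym/eqP.
by rewrite addrC addr_eq0 => /eqP->.
Qed.

Lemma val_ge0 m : val_ge w m 0.
Proof. by rewrite /val_ge (valuation0 hw) leey. Qed.

Lemma val_ge1 : val_ge w 0 1.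
Proof. by rewrite /val_ge val1. Qed.

Lemma val_geW m n x : m <= n -> val_ge w n x -> val_ge w m x.
Proof. by move=> mn; apply: le_trans; rewrite lee_fin. Qed.

Lemma val_geD m x y : val_ge w m x -> val_ge w m y -> val_ge w m (x + y).
Proof.
by move=> hx hy; apply: le_trans (valuationD hw _ _); rewrite le_min; apply/andP.
Qed.

Lemma val_geM m n x y : val_ge w m x -> val_ge w n y -> val_ge w (m + n) (x * y).
Proof. by move=> hx hy; rewrite /val_ge (valuationM hw) EFinD leeD. Qed.

Lemma val_geN m x : val_ge w m x -> val_ge w m (- x).
Proof.
have N1 : -1 != 0 :> K by rewrite oppr_eq0 oner_eq0.
have [c wc] := val_fin N1; have := valX 2 wc; rewrite sqrrN expr1n val1 => -[] /esym/eqP.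
rewrite mulrn_eq0 /= => /eqP c0 hx; rewrite -mulN1r -[m]add0r.
by apply: val_geM => //; rewrite /val_ge wc c0.
Qed.

Lemma val_ge_sum m I (r : seq I) (P : pred I) (F : I -> K) :
  (forall i, P i -> val_ge w m (F i)) -> val_ge w m (\sum_(i <- r | P i) F i).
Proof.
by move=> h; elim/big_ind: _ => //; [apply: val_ge0 | move=> *; apply: val_geD].
Qed.

Lemma val_geX m n x : val_ge w m x -> val_ge w (m *+ n) (x ^+ n).
Proof.
move=> hx; elim: n => [|n IH]; first exact: val_ge1.
by rewrite exprS mulrS; apply: val_geM.
Qed.

Lemma val_ge_divl m n x y : y != 0 -> w y = n%:E ->
  val_ge w (m + n) (y * x) -> val_ge w m x.
Proof.
move=> y0 wy h; have hV : val_ge w (- n) y^-1 by rewrite /val_ge (valV y0 wy).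
by have := val_geM hV h; rewrite mulKf // addrCA addNr addr0.
Qed.

(** A root has no worse poles than the coefficients once its leading coefficient
is cleared: where [b] has a pole, divide the equation [sum_i F_i b^i = 0] of
degree [d] by [b^(d-1)] and solve it for [F_d b]. *)
Lemma val_ge_lead_root m (F : {poly K}) b :
  (forall i, val_ge w m F`_i) -> root F b -> val_ge w m (lead_coef F * b).
Proof.
move=> hF /eqP Fb; have [->|b0] := eqVneq b 0; first by rewrite mulr0; apply: val_ge0.
have [c wc] := val_fin b0; have [c0|c0] := lerP 0 c.
  by rewrite -[m]addr0; apply: val_geM; [apply: hF | rewrite /val_ge wc lee_fin].
have binv : val_ge w 0 b^-1 by rewrite /val_ge (valV b0 wc) lee_fin oppr_ge0 ltW.
have [->|F0] := eqVneq F 0; first by rewrite lead_coef0 mul0r; apply: val_ge0.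
move: Fb; rewrite horner_coef lead_coefE (polySpred F0) /=; case: (size F).-1 => [|d].
  by rewrite big_ord1 expr0 mulr1 => ->; rewrite mul0r; apply: val_ge0.
rewrite big_ord_recr /= => /eqP; rewrite addrC addr_eq0 => /eqP FE.
have -> : F`_d.+1 * b = \sum_(i < d.+1) - (F`_i * b^-1 ^+ (d - i)).
  apply: (mulIf (expf_neq0 d b0)); rewrite -mulrA -exprS FE mulr_suml -sumrN.
  apply: eq_bigr => i _; rewrite !mulNr -mulrA; congr (- (_ * _)).
  have -> : b ^+ d = b ^+ (d - i) * b ^+ i by rewrite -exprD subnK // leq_ord.
  by rewrite mulrA -exprMn mulVf // expr1n mul1r.
apply: val_ge_sum => i _; apply: val_geN; rewrite -[m]addr0.
by apply: val_geM => //; have := val_geX (d - i) binv; rewrite mul0rn.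
Qed.

End Valuation.

Lemma closed_nth_root (k : closedFieldType) (n : nat) (c : k) :
  exists d, d ^+ n.+1 = c.
Proof.
have [|d] := closed_rootP ('X^(n.+1) - c%:P) _; first by rewrite size_XnsubC.
by rewrite /root !hornerE subr_eq0 => /eqP; exists d.
Qed.

Section Residue.
Variables (k : closedFieldType) (K : fieldExtType (ratfun k)).
Variables (w : K -> \bar int) (hw : normalized_valuation w).
Local Notation const_in := (const_in K).

(** A nonzero constant has roots of every order in [k], so its valuation is
divisible by every integer. *)
Lemma val_const c : c != 0 -> w (const_in c) = 0%E.
Proof.
move=> c0; have [m wm] : exists m : int, w (const_in c) = m%:E.
  by apply: (val_fin hw); rewrite fmorph_eq0.
have [d dc] := closed_nth_root `|m|%N c.
have [m' wm'] : exists m : int, w (const_in d) = m%:E.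
  apply: (val_fin hw); rewrite fmorph_eq0; apply: contra_neq c0 => d0.
  by rewrite -dc d0 expr0n.
have := valX hw `|m|.+1 wm'; rewrite -rmorphXn dc wm => -[] => mE.
suff -> : m = 0 by [].
move: mE; rewrite -mulr_natr natz; have [->|m'0] := eqVneq m' 0; first by move=> ->; rewrite mul0r.
by move/(congr1 absz); rewrite abszM /= => mE; have := leq_pmull `|m|.+1 (n := `|m'|);
  rewrite absz_gt0 m'0 -mE ltnn => /(_ isT).
Qed.

Lemma val_ge_const c : val_ge w 0 (const_in c).
Proof.
have [->|c0] := eqVneq c 0; first by rewrite rmorph0; apply: (val_ge0 hw).
by rewrite /val_ge val_const.
Qed.

(** The residue field is algebraic over [k], hence equal to it: reduce an
algebraic relation between [x] and a uniformizer. *)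
Lemma residue x : val_ge w 0 x -> exists c, val_ge w 1 (x - const_in c).
Proof.
move=> x0; apply: contrapT => /forallNP noc.
have xc c : w (x - const_in c) = 0%E.
  have ge0 : val_ge w 0 (x - const_in c).
    by apply: (val_geD hw) => //; apply/(val_geN hw)/val_ge_const.
  have [z|nz] := eqVneq (x - const_in c) 0.
    by case: (noc c); rewrite z; apply: (val_ge0 hw).
  have [m wm] := val_fin hw nz; move: ge0 (noc c); rewrite /val_ge wm !lee_fin.
  by move=> m0 /negP; rewrite -ltNge => m1; congr (_%:E); lia.
have wpoly (p : {poly k}) : p != 0 -> w (map_poly const_in p).[x] = 0%E.
  move=> p0; have [s _ ->] := closed_factors p0.
  rewrite map_polyZ hornerZ (valuationM hw) val_const ?lead_coef_eq0 // add0e.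
  elim: s => [|c s IH]; first by rewrite big_nil rmorph1 hornerC (val1 hw).
  rewrite big_cons rmorphM hornerM (valuationM hw) IH adde0.
  by rewrite rmorphB /= map_polyX map_polyC hornerXsubC xc.
(* In a relation between [x] and the uniformizer [p], the coefficient of the
lowest power of [p] is a polynomial in [x] of positive value. *)
have [p p0 wp] := uniformizer hw.
have [r [u [i0 [j0 uij]] uE]] := algebraic_dependence p x.
pose P (i : 'I_r) : {poly k} := \sum_j u i j *: 'X^j.
have PE i : (map_poly const_in (P i)).[x] = \sum_j const_in (u i j) * x ^+ j.
  rewrite rmorph_sum horner_sum; apply: eq_bigr => j _ /=.
  by rewrite map_polyZ map_polyXn hornerZ hornerXn.
have Pi0 : P i0 != 0.
  apply: contra_neq uij => /(congr1 (fun F : {poly k} => F`_j0)).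
  rewrite coef0 coef_sum (bigD1 j0) //= big1 ?addr0 ?coefZ ?coefXn ?eqxx ?mulr1 //.
  by move=> l li; rewrite coefZ coefXn eq_sym (inj_eq val_inj) (negPf li) mulr0.
have [i Pi imin] : exists2 i : 'I_r, P i != 0 & forall l : 'I_r, P l != 0 -> (i <= l)%N.
  by case: (@arg_minnP _ i0 (fun i => P i != 0) val Pi0) => i; exists i.
have vpoly l : val_ge w 0 (map_poly const_in (P l)).[x].
  have [->|/wpoly wl] := eqVneq (P l) 0; last by rewrite /val_ge wl.
  by rewrite rmorph0 horner0; apply: (val_ge0 hw).
have: \sum_(l < r) p ^+ l * (map_poly const_in (P l)).[x] = 0.
  rewrite -[RHS]uE; apply: eq_bigr => l _; rewrite PE mulr_sumr.
  by apply: eq_bigr => j _; rewrite mulrA (mulrC (p ^+ l)).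
rewrite (bigD1 i) //= => /eqP; rewrite addr_eq0 => /eqP lE.
have wi : w (p ^+ i * (map_poly const_in (P i)).[x]) = (i%:Z)%:E.
  by rewrite (valuationM hw) (valX hw i wp) wpoly // adde0 natz.
suff : val_ge w (i%:Z + 1) (p ^+ i * (map_poly const_in (P i)).[x]).
  by rewrite /val_ge wi lee_fin; lia.
rewrite lE; apply/(val_geN hw)/(val_ge_sum hw) => l li.
have [Pl|Pl] := eqVneq (P l) 0.
  by rewrite Pl rmorph0 horner0 mulr0; apply: (val_ge0 hw).
have il : (i < l)%N by rewrite ltn_neqAle imin // (inj_eq val_inj) eq_sym li.
apply: (@val_geW _ _ _ (l%:Z + 0)); first by lia.
by apply: (val_geM hw) => //; rewrite /val_ge (valX hw l wp) natz.
Qed.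

End Residue.

(** * Valuation rings *)

Section ValuationRing.
Variables (K : fieldType) (A : set K).
Hypotheses (A1 : A 1) (AB : forall x y, A x -> A y -> A (x - y))
  (AM : forall x y, A x -> A y -> A (x * y)).

Lemma subring0 : A 0. Proof. by rewrite -(subrr 1); apply: AB. Qed.
Lemma subringN x : A x -> A (- x).
Proof. by rewrite -sub0r; apply: AB; apply: subring0. Qed.
Lemma subringD x y : A x -> A y -> A (x + y).
Proof. by move=> Ax Ay; rewrite -[y]opprK; apply: AB => //; apply: subringN. Qed.
Lemma subring_sum I (r : seq I) (P : pred I) (F : I -> K) :
  (forall i, P i -> A (F i)) -> A (\sum_(i <- r | P i) F i).
Proof.
by move=> h; elim/big_ind: _ => //; [apply: subring0 | apply: subringD].
Qed.
Lemma subringX x n : A x -> A (x ^+ n).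
Proof. by move=> Ax; elim: n => // n IH; rewrite exprS; apply: AM. Qed.

(** A subring that avoids [z], contains [1/z] and is maximal with these two
properties is a valuation ring. *)
Section Maximal.
Variable z : K.
Hypotheses (Az : ~ A z) (AzV : A z^-1).
Hypothesis Amax : forall B : set K, B 1 -> (forall x y, B x -> B y -> B (x - y)) ->
  (forall x y, B x -> B y -> B (x * y)) -> A `<=` B -> ~ B z -> B `<=` A.

Let z0 : z != 0.
Proof. by apply: contra_notN Az => /eqP->; apply: subring0. Qed.

(** Inverting [1 - a/z] does not bring [z] into the ring: [z = b / (1 - a/z)^r]
implies [(1 - a/z)^r = b/z], and then [1/z] would be invertible. *)
Let unit_sub a : A a -> 1 - a / z != 0 /\ A (1 - a / z)^-1.
Proof.
move=> Aa; set c := 1 - a / z.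
have Ac : A c by apply: AB => //; apply: AM.
have c0 : c != 0.
  apply: contra_notN Az; rewrite subr_eq0 => /eqP cE.
  by rewrite -[z]mul1r cE divfK.
split=> //.
have expc r : exists2 b, A b & c ^+ r = 1 - b / z.
  elim: r => [|r [b Ab IH]]; first by exists 0; [apply: subring0 | rewrite mul0r subr0].
  exists (b + a * c ^+ r); first by apply: subringD => //; apply: AM => //; apply: subringX.
  by rewrite exprS {1}/c mulrBl mul1r {1}IH mulrDl opprD addrA mulrAC.
pose B : set K := [set x | exists r, A (x * c ^+ r)].
apply: (Amax (B := B)).
- by exists 0%N; rewrite mulr1.
- move=> x y [r Ax] [s Ay]; exists (r + s)%N; rewrite mulrBl exprD; apply: AB.
    by rewrite mulrA; apply: AM => //; apply: subringX.
  by rewrite mulrCA mulrC; apply: AM => //; apply: subringX.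
- by move=> x y [r Ax] [s Ay]; exists (r + s)%N; rewrite exprD mulrACA; apply: AM.
- by move=> x Ax; exists 0%N; rewrite mulr1.
- move=> [r]; have [b Ab ->] := expc r; rewrite mulrBr mulr1 mulrCA divff // mulr1.
  by move=> Azb; apply: Az; rewrite -[z](subrK b); apply: subringD.
- by exists 1%N; rewrite mulVf.
Qed.

Let poly_value x n := exists p : {poly K}, [/\ forall i, A p`_i, (size p <= n)%N & p.[x] = z].

Let poly_value1 x n : poly_value x n -> (1 < n)%N.
Proof.
case=> p [Ap sp pz]; rewrite ltnNge; apply: contra_notN Az => n1.
rewrite -pz (@horner_coef_wide _ 1) ?(leq_trans sp) // big_ord1 mulr1; exact: Ap.
Qed.

(** An expression [z = q(1/x)] writes the unit [1 - q(0)/z] as a combination of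
negative powers of [x]. Times a power of [x], this serves to eliminate the
leading term of an expression of [z] as a polynomial in [x]. *)
Let poly_value_reduce x n m : x != 0 -> (m <= n.+1)%N ->
  poly_value x n.+2 -> poly_value x^-1 m.+1 -> poly_value x n.+1.
Proof.
move=> x0 mn [p [Ap sp pz]] [q [Aq sq qz]].
have [c0 AcV] := unit_sub (Aq 0%N); set c := 1 - _ in c0 AcV.
pose d j := p`_n.+1 * (q`_j.+1 / z / c).
exists (take_poly n.+1 p + \sum_(j < m) d j *: 'X^(n - j)).
have Ad j : A (d j) by do 3![apply: AM => //].
split.
- move=> i; rewrite coefD coef_sum coef_take_poly; apply: subringD.
    by case: ifP => // _; apply: subring0.
  apply: subring_sum => j _; rewrite coefZ coefXn; apply: AM => //.
  by case: (_ == _); [apply: A1 | apply: subring0].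
- rewrite (leq_trans (size_polyD _ _)) // geq_max size_take_poly /=.
  rewrite (leq_trans (size_sum _ _ _)) //; apply/bigmax_leqP => j _.
  by rewrite (leq_trans (size_scale_leq _ _)) // size_polyXn ltnS leq_subr.
rewrite hornerD -[RHS]pz [in RHS](horner_coef_wide _ sp) big_ord_recr /=.
congr (_ + _).
  rewrite (@horner_coef_wide _ n.+1) ?size_take_poly //; apply: eq_bigr => i _.
  by rewrite coef_take_poly ltn_ord.
suff xn : x ^+ n.+1 = \sum_(j < m) q`_j.+1 / z / c * x ^+ (n - j).
  rewrite xn mulr_sumr horner_sum; apply: eq_bigr => j _.
  by rewrite hornerZ hornerXn mulrA.
have cE : c = \sum_(j < m) q`_j.+1 / z * x^-1 ^+ j.+1.
  rewrite /c -[X in X - _](divff z0) -{1}qz (horner_coef_wide _ sq) big_ord_recl /=.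
  rewrite mulr1 -mulrBl addrAC subrr add0r mulr_suml; apply: eq_bigr => j _.
  by rewrite mulrAC.
apply: (mulfI c0); rewrite {1}cE mulr_suml mulr_sumr; apply: eq_bigr => j _.
rewrite [in RHS]mulrA [c * _]mulrC divfK // -[LHS]mulrA; congr (_ * _).
have -> : n.+1 = (j.+1 + (n - j))%N by have := ltn_ord j; lia.
by rewrite exprD mulrA -exprMn mulVf // expr1n mul1r.
Qed.

(** If neither [x] nor [1/x] belonged to the ring, [z] would be a polynomial in
both; of two such expressions of least degree the longer one could be
shortened. *)
Lemma maximal_total x : A x \/ A x^-1.
Proof.
have [->|x0] := eqVneq x 0; first by left; apply: subring0.
apply: contrapT => /not_orP[nAx nAxV].
have adj y : ~ A y -> exists n, poly_value y n.
  move=> nAy; apply: contrapT => nv; apply: nAy.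
  apply: (Amax (B := [set b | exists2 p : {poly K}, forall i, A p`_i & p.[y] = b])).
  - exists 1; last by rewrite hornerC.
    by move=> i; rewrite coef1; case: (_ == _); [apply: A1 | apply: subring0].
  - move=> _ _ [p Ap <-] [q Aq <-]; exists (p - q); last by rewrite hornerD hornerN.
    by move=> i; rewrite coefB; apply: AB.
  - move=> _ _ [p Ap <-] [q Aq <-]; exists (p * q); last by rewrite hornerM.
    by move=> i; rewrite coefM; apply: subring_sum => j _; apply: AM.
  - move=> a Aa; exists a%:P; last by rewrite hornerC.
    by move=> i; rewrite coefC; case: (_ == _) => //; apply: subring0.
  - by move=> [p Ap pz]; apply: nv; exists (size p), p.
  - exists 'X; last by rewrite hornerX.
    by move=> i; rewrite coefX; case: (_ == _); [apply: A1 | apply: subring0].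
have minv y : ~ A y -> exists n, poly_value y n.+2 /\ forall m, poly_value y m -> (n.+1 < m)%N.
  move=> nAy; have [n0 vn0] := adj y nAy.
  have ex : exists n, `[< poly_value y n >] by exists n0; apply/asboolP.
  case: (ex_minnP ex) => n /asboolP vn nmin; have := poly_value1 vn.
  case: n vn nmin => [|[|n]] // vn nmin _; exists n; split=> // m vm.
  by apply: nmin; apply/asboolP.
have [n [vn nmin]] := minv _ nAx; have [m [vm mmin]] := minv _ nAxV.
have [mn|nm] := leqP m n.
  by have := nmin _ (poly_value_reduce (m := m.+1) x0 mn vn vm); rewrite ltnn.
have vn' : poly_value x^-1^-1 n.+2 by rewrite invrK.
have := mmin _ (poly_value_reduce (m := n.+1) (invr_neq0 x0) (ltnW nm) vm vn').
by rewrite ltnn.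
Qed.

End Maximal.
End ValuationRing.

Definition valuation_ring (K : fieldType) (A : set K) : Prop :=
  [/\ A 1, forall x y, A x -> A y -> A (x - y), forall x y, A x -> A y -> A (x * y) &
      forall x, A x \/ A x^-1].

Lemma valuation_ring_avoiding (K : fieldType) (A0 : set K) (z : K) :
  A0 1 -> (forall x y, A0 x -> A0 y -> A0 (x - y)) ->
  (forall x y, A0 x -> A0 y -> A0 (x * y)) -> A0 z^-1 -> ~ A0 z ->
  exists A, [/\ valuation_ring A, A0 `<=` A & ~ A z].
Proof.
move=> A01 A0B A0M A0z A0nz.
pose P (A : set K) := [/\ forall x y, A x -> A y -> A (x - y),
  forall x y, A x -> A y -> A (x * y), A0 `<=` A & ~ A z].
(* The union of the empty chain is empty, hence the first alternative. *)
have [|A [[AE|[AB AM A0A Az]] Amax]] := @Zorn_bigcup K (fun A => A = set0 \/ P A).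
- move=> F FP totF.
  have [[A FA PA]|noP] := pselect (exists2 A, F A & P A); last first.
    left; apply/seteqP; split=> // x [A FA]; have [->//|PA] := FP A FA.
    by case: noP; exists A.
  right; have [AB AM A0A Az] := PA.
  have both x y : (\bigcup_(X in F) X) x -> (\bigcup_(X in F) X) y ->
      exists X, [/\ F X, P X, X x & X y].
    move=> [X FX Xx] [Y FY Yy].
    have XP (Z : set K) t : F Z -> Z t -> P Z by move=> /FP[->|].
    by have [XY|YX] := totF X Y FX FY; [exists Y|exists X]; split=> //;
      do [exact: XP FY Yy | exact: XP FX Xx | exact: XY | exact: YX].
  split.
  + by move=> x y /both h /h [X [FX [XB _ _ _] Xx Xy]]; exists X => //; apply: XB.
  + by move=> x y /both h /h [X [FX [_ XM _ _] Xx Xy]]; exists X => //; apply: XM.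
  + by move=> x A0x; exists A => //; apply: A0A.
  + by move=> [X FX Xz]; have [XE|[]//] := FP X FX; rewrite XE in Xz.
- exfalso; apply: (Amax A0); last by right; split.
  by rewrite AE; split=> // sub; apply: sub A01.
exists A; split => //; split => //; first exact: A0A.
apply: (@maximal_total _ _ _ AB AM z Az) => //; [exact: A0A | exact: A0A |].
move=> B _ BB BM AsB Bz x Bx; apply: contrapT => Ax.
apply: (Amax B); last by right; split => //; apply: subset_trans AsB.
by split=> // BA; apply/Ax/BA.
Qed.

(** Since [1/z] is transcendental over [k], the ring [k[1/z]] does not contain
[z]. *)
Lemma valuation_ring_over_constants (k : closedFieldType) (K : fieldExtType (ratfun k)) (z : K) :
  (forall c, z != const_in K c) ->
  exists A : set K, [/\ valuation_ring A, forall c, A (const_in K c) & ~ A z].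
Proof.
move=> zc; pose ev (p : {poly k}) : K := (map_poly (const_in K) p).[z^-1].
have [||||| A [vA A0A Az]] := @valuation_ring_avoiding K (range ev) z.
- by exists 1 => //; rewrite /ev rmorph1 hornerC.
- by move=> _ _ [p _ <-] [q _ <-]; exists (p - q); rewrite // /ev rmorphB hornerD hornerN.
- by move=> _ _ [p _ <-] [q _ <-]; exists (p * q); rewrite // /ev rmorphM hornerM.
- by exists 'X; rewrite // /ev map_polyX hornerX.
- move=> [p _ pz].
  have zVc c : z^-1 != const_in K c.
    apply/eqP => /(congr1 GRing.inv); rewrite invrK -fmorphV => /eqP.
    by apply/negP/zc.
  have z0 : z != 0 by rewrite -(rmorph0 (const_in K)) zc.
  have: 'X * p - 1 != 0 :> {poly k}.
    apply/eqP => /(congr1 (fun q : {poly k} => q`_0)).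
    by rewrite coefB coefXM coef1 coef0 sub0r => /eqP; rewrite oppr_eq0 oner_eq0.
  move=> /(transcendental zVc); rewrite rmorphB rmorphM /= map_polyX rmorph1.
  by rewrite hornerD hornerN hornerM hornerX hornerC -/(ev p) pz mulVf // subrr eqxx.
exists A; split=> // c; apply: A0A; exists c%:P => //.
by rewrite /ev map_polyC hornerC.
Qed.

Section ValuationRingTheory.
Variables (K : fieldType) (A : set K).
Hypothesis hA : valuation_ring A.

Let A1 : A 1. Proof. by case: hA. Qed.
Let AB x y : A x -> A y -> A (x - y). Proof. by case: hA => _ + _ _; apply. Qed.
Let AM x y : A x -> A y -> A (x * y). Proof. by case: hA => _ _ + _; apply. Qed.
Let Atot x : A x \/ A x^-1. Proof. by case: hA. Qed.
Let A0 : A 0. Proof. exact: subring0 A1 AB. Qed.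
Let AN x : A x -> A (- x). Proof. exact: (subringN A1 AB). Qed.

Definition ring_unit (x : K) : Prop := [/\ x != 0, A x & A x^-1].
(** The nonunits form the maximal ideal of the valuation ring. *)
Definition nonunit (x : K) : Prop := A x /\ ~ ring_unit x.
(** Associates are the elements with the same value. *)
Definition assoc (x y : K) : Prop := ring_unit (x / y).

Lemma unit1 : ring_unit 1.
Proof. by split; rewrite ?oner_eq0 ?invr1. Qed.

Lemma unitM x y : ring_unit x -> ring_unit y -> ring_unit (x * y).
Proof.
by move=> [x0 Ax AVx] [y0 Ay AVy]; split; rewrite ?mulf_neq0 ?invfM //; apply: AM.
Qed.

Lemma unitV x : ring_unit x -> ring_unit x^-1.
Proof. by move=> [x0 Ax AVx]; split; rewrite ?invr_eq0 ?invrK. Qed.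

Lemma unit_or_nonunit x : A x -> ring_unit x \/ nonunit x.
Proof. by move=> Ax; have [ux|nux] := pselect (ring_unit x); [left|right]. Qed.

Lemma nonunitV x : ~ A x -> nonunit x^-1.
Proof.
move=> nAx; have [//|AVx] := Atot x; split=> // -[_ _]; by rewrite invrK.
Qed.

Lemma nonunit_inv x : nonunit x -> x != 0 -> ~ A x^-1.
Proof. by move=> [Ax nu] x0 AVx; apply: nu. Qed.

Lemma nonunitM x y : nonunit x -> A y -> nonunit (x * y).
Proof.
move=> [Ax nux] Ay; split; first exact: AM.
move=> [xy0 _ AV]; move: (xy0); rewrite mulf_eq0 => /norP[x0 y0]; apply: nux.
split=> //; have -> : x^-1 = y * (x * y)^-1 by rewrite invfM mulrCA divff ?mulr1.
exact: AM.
Qed.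

Lemma nonunit0 : nonunit 0.
Proof. by split=> // -[/eqP]. Qed.

Lemma nonunitD x y : nonunit x -> nonunit y -> nonunit (x + y).
Proof.
have [->|x0] := eqVneq x 0; first by rewrite add0r.
have [->|y0] := eqVneq y 0; first by rewrite addr0.
move=> Mx My; have [xy|yx] := Atot (x / y).
  have -> : x + y = y * (x / y + 1) by rewrite mulrDr mulr1 mulrCA divff ?mulr1.
  by apply: nonunitM => //; apply: (subringD A1 AB).
rewrite invf_div in yx; have -> : x + y = x * (1 + y / x).
  by rewrite mulrDr mulr1 mulrCA divff ?mulr1.
by apply: nonunitM => //; apply: (subringD A1 AB).
Qed.

Lemma nonunitN x : nonunit x -> nonunit (- x).
Proof. by move=> Mx; rewrite -mulrN1; apply: nonunitM => //; apply: AN. Qed.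

Lemma nonunit_sum I (r : seq I) (P : pred I) (F : I -> K) :
  (forall i, P i -> nonunit (F i)) -> nonunit (\sum_(i <- r | P i) F i).
Proof.
by move=> h; elim/big_ind: _ => //; [apply: nonunit0 | apply: nonunitD].
Qed.

Lemma unit_addN x y : ring_unit x -> nonunit y -> ring_unit (x + y).
Proof.
move=> ux My; have Axy : A (x + y) by apply: (subringD A1 AB); [case: ux|case: My].
have [//|Mxy] := unit_or_nonunit Axy; case: ux => x0 Ax AVx; exfalso.
have := nonunitD Mxy (nonunitN My); rewrite addrK => Mx.
exact: nonunit_inv Mx x0 AVx.
Qed.

Lemma assoc_refl x : x != 0 -> assoc x x.
Proof. by move=> x0; rewrite /assoc divff //; apply: unit1. Qed.

Lemma assoc_sym x y : assoc x y -> assoc y x.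
Proof. by move=> /unitV; rewrite /assoc invf_div. Qed.

Lemma assoc_neq0 x y : assoc x y -> x != 0 /\ y != 0.
Proof. by case; rewrite mulf_eq0 invr_eq0 => /norP. Qed.

Lemma assocM x y x' y' : assoc x y -> assoc x' y' -> assoc (x * x') (y * y').
Proof. by move=> /unitM h /h; rewrite /assoc mulf_div. Qed.

Lemma assoc_trans y x z : assoc x y -> assoc y z -> assoc x z.
Proof.
move=> xy; have [x0 y0] := assoc_neq0 xy; move: xy => /unitM h /h.
by rewrite /assoc mulrA divfK.
Qed.

Lemma assocV x y : assoc x y -> assoc x^-1 y^-1.
Proof. by move=> /unitV; rewrite /assoc invfM. Qed.

Lemma assocX x y (n : int) : assoc x y -> assoc (x ^ n) (y ^ n).
Proof.
have nat_case m : assoc x y -> assoc (x ^+ m) (y ^+ m).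
  move=> xy; elim: m => [|m IH]; last by rewrite !exprS; apply: assocM.
  by rewrite !expr0; apply/assoc_refl/oner_neq0.
by case: n => m /nat_case h; rewrite ?NegzE -?invr_expz -?exprnP //; apply: assocV.
Qed.

Lemma assoc_in x y : assoc x y -> A y -> A x.
Proof.
move=> xy Ay; have [x0 y0] := assoc_neq0 xy; case: xy => _ Axy _.
by rewrite -[x](divfK y0); apply: AM.
Qed.

Lemma ring_exp_ge0 x (m : int) : A x -> 0 <= m -> A (x ^ m).
Proof. by move=> Ax; case: m => // m _; rewrite -exprnP; apply: (subringX A1 AM). Qed.

Lemma nonunit_exp_ge0 p (m : int) : nonunit p -> p != 0 -> A (p ^ m) -> 0 <= m.
Proof.
move=> Mp p0 Apm; rewrite leNgt; apply/negP => m0; apply: (nonunit_inv Mp p0).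
have -> : p^-1 = p ^ m * p ^ (- m - 1) by rewrite -expfzDr // addrA subrr add0r.
by apply: AM => //; apply: ring_exp_ge0; [case: Mp | lia].
Qed.

(** Divisibility by elements of a valuation ring is a total preorder. *)
Lemma exists_common_divisor (s : seq K) : s != [::] -> all (fun x => x != 0) s ->
  exists2 y, y \in s & forall x, x \in s -> A (x / y).
Proof.
elim: s => // x s IH _ /= /andP[x0 s0].
have [->|sn0] := eqVneq s [::].
  by exists x; rewrite ?mem_head // => y; rewrite inE => /eqP->; rewrite divff.
have [y ys yP] := IH sn0 s0; have y0 := allP s0 y ys.
have [xy|yx] := Atot (x / y).
  by exists y => [|u]; rewrite inE ?ys ?orbT // => /orP[/eqP->|/yP].
exists x => [|u]; rewrite inE ?eqxx // => /orP[/eqP->|us]; first by rewrite divff.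
rewrite invf_div in yx; by rewrite -[u](divfK y0) -(mulrA (u / y)); apply: AM => //; apply: yP.
Qed.

(** If the terms had distinct values, division by the one of least value would
leave the sum of [1] and nonunits. *)
Lemma vanishing_sum_assoc (I : finType) (T : I -> K) (P : pred I) :
  (exists i, P i) -> (forall i, P i -> T i != 0) -> \sum_(i | P i) T i = 0 ->
  exists i j, [/\ P i, P j, i != j & assoc (T i) (T j)].
Proof.
move=> [i0 Pi0] T0 sumT.
have [||y] := @exists_common_divisor [seq T i | i <- enum P].
- have : T i0 \in [seq T i | i <- enum P] by apply: map_f; rewrite mem_enum.
  by case: [seq T i | i <- enum P].
- by apply/allP => _ /mapP[i + ->]; rewrite mem_enum => /T0.
case/mapP => j; rewrite mem_enum => Pj -> {y} jmin.
apply: contrapT => nassoc.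
have: nonunit (\sum_(i | P i && (i != j)) T i / T j).
  apply: nonunit_sum => i /andP[Pi ij].
  have [|u|//] := @unit_or_nonunit (T i / T j).
    by apply: jmin; apply: map_f; rewrite mem_enum.
  by case: nassoc; exists i, j.
move: sumT; rewrite (bigD1 j) //= addrC -mulr_suml => /eqP; rewrite addr_eq0 => /eqP->.
rewrite mulNr divff ?T0 // => /nonunitN; rewrite opprK => M1.
by apply: nonunit_inv M1 _ _; rewrite ?oner_eq0 ?invr1.
Qed.

End ValuationRingTheory.

Section ValuationRingOfFunctionField.
Variables (k : closedFieldType) (K : fieldExtType (ratfun k)) (A : set K) (z : K).
Hypotheses (hA : valuation_ring A) (Ac : forall c, A (const_in K c)) (Az : ~ A z).

Let A1 : A 1. Proof. by case: hA. Qed.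
Let AB x y : A x -> A y -> A (x - y). Proof. by case: hA => _ + _ _; apply. Qed.
Let AM x y : A x -> A y -> A (x * y). Proof. by case: hA => _ _ + _; apply. Qed.
Let Atot x : A x \/ A x^-1. Proof. by case: hA. Qed.
Let AX x n : A x -> A (x ^+ n). Proof. exact: (subringX A1 AM). Qed.

Lemma const_unit c : c != 0 -> ring_unit A (const_in K c).
Proof. by move=> c0; split; [rewrite fmorph_eq0 | apply: Ac | rewrite -fmorphV; apply: Ac]. Qed.

Lemma poly_in_ring p : A (tvar K) -> A (poly_in K p).
Proof.
move=> At; rewrite poly_inE horner_coef; apply: (subring_sum A1 AB) => i _.
by rewrite coef_map; apply: AM; [apply: Ac | apply: AX].
Qed.

Lemma in_algE (f : ratfun k) :
  f%:A = poly_in K \n_(repr f) / poly_in K \d_(repr f).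
Proof.
apply: (canRL (mulfK _)); first by rewrite poly_in_eq0 numden_neq0.
rewrite /poly_in mulr_algl scalerA.
by rewrite {1}[f]numdenE divfK // tofrac_eq0 numden_neq0.
Qed.

Lemma numerator_neq0 (f : ratfun k) : f != 0 -> \n_(repr f) != 0.
Proof. by move=> f0; apply: contra_neq f0 => n0; rewrite [f]numdenE n0 tofrac0 mul0r. Qed.

(** Valuation rings are integrally closed, and [K] is integral over [k(t)]. *)
Lemma ring_not_over_ratfun : ~ forall f : ratfun k, A f%:A.
Proof.
move=> Af; have /polyOver1P[p pE] := minPolyOver 1 z.
have := root_minPoly 1 z; have := monic_minPoly 1 z; rewrite pE.
rewrite map_monic => pm pz; apply: Az.
have Mz := nonunitV hA Az; have z0 : z != 0.
  by apply: contra_notN Az => /eqP->; apply: (subring0 A1 AB).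
move: pz; rewrite /root horner_coef size_map_poly.
rewrite (polySpred (monic_neq0 pm)) big_ord_recr /= coef_map /= -lead_coefE.
rewrite (monicP pm) scale1r mul1r addrC addr_eq0 => /eqP zE.
have : nonunit A (- \sum_(i < (size p).-1) (p`_i)%:A * z^-1 ^+ ((size p).-1 - i)).
  apply/(nonunitN hA)/(nonunit_sum hA) => i _; rewrite mulrC.
  have -> : ((size p).-1 - i = ((size p).-1 - i).-1.+1)%N.
    by rewrite prednK // subn_gt0.
  by rewrite exprS; do 2!apply: (nonunitM hA) => //; apply: AX; case: Mz.
suff -> : - \sum_(i < (size p).-1) (p`_i)%:A * z^-1 ^+ ((size p).-1 - i) = 1.
  by move=> M1; case: (nonunit_inv M1); rewrite ?oner_eq0 ?invr1.
apply: (mulfI (expf_neq0 (size p).-1 z0)); rewrite mulr1 [RHS]zE mulrN; congr (- _).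
rewrite mulr_sumr; apply: eq_bigr => i _; rewrite coef_map /= mulrCA; congr (_ * _).
by rewrite -{1}(subnK (ltnW (ltn_ord i))) exprD mulrAC -exprMn divff // expr1n mul1r.
Qed.

(** The ring [A] induces on [k(t)] the valuation [v], with uniformizer [t'];
[t'] need not be a uniformizer of [A]. *)
Definition represents (v : ratfun k -> \bar int) (t' : K) : Prop :=
  [/\ ratfun_places v, nonunit A t', t' != 0 &
    forall f : ratfun k, f != 0 -> exists2 n : int, v f = n%:E & assoc A f%:A (t' ^ n)].

(** A polynomial that does not vanish at [a] is a nonzero constant up to a
multiple of [t - a]. *)
Let represents_finite a : A (tvar K) -> nonunit A (poly_in K ('X - a%:P)) ->
  represents (v_at a) (poly_in K ('X - a%:P)).
Proof.
move=> At Mt; set t' := poly_in K _ in Mt *.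
have t0 : t' != 0 by rewrite poly_in_eq0 polyXsubC_eq0.
have poly_assoc p : p != 0 -> assoc A (poly_in K p) (t' ^+ mup a p).
  move=> p0; have [m [q /implyP/(_ p0) qa pE]] := multiplicity_XsubC p a.
  rewrite pE mupMr // mup_XsubCX eqxx rmorphM rmorphXn /assoc mulfK ?expf_neq0 //.
  have /factor_theorem[r rE] : root (q - q.[a]%:P) a.
    by rewrite /root !hornerE subrr.
  have -> : q = q.[a]%:P + r * ('X - a%:P) by rewrite -rE addrCA subrr addr0.
  rewrite rmorphD rmorphM; apply: (unit_addN hA); first exact: const_unit.
  by rewrite mulrC; apply: (nonunitM hA) => //; apply: poly_in_ring.
split=> //; first by right; exists a.
move=> f f0; exists ((mup a \n_(repr f))%:Z - (mup a \d_(repr f))%:Z).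
  by rewrite /v_at (negPf f0).
rewrite in_algE expfzDr // -invr_expz -!exprnP.
apply: (assocM hA); first exact/poly_assoc/numerator_neq0.
exact/assocV/poly_assoc/numden_neq0.
Qed.

(** A polynomial of degree [d] is [t^d] times its leading coefficient up to a
multiple of [1/t]. *)
Let represents_infinite : ~ A (tvar K) -> represents (@v_infty k) (tvar K)^-1.
Proof.
move=> nAt; have Mt := nonunitV hA nAt.
have t0 : tvar K != 0 by rewrite poly_in_eq0 polyX_eq0.
have cancel (x y u : K) : y != 0 -> x * y / (y * u) = u^-1 * x.
  by move=> y0; rewrite invfM mulrA mulfK // mulrC.
have poly_assoc p : p != 0 -> assoc A (poly_in K p) (tvar K ^+ (size p).-1).
  move=> p0; rewrite /assoc poly_inE horner_coef size_map_poly.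
  rewrite (polySpred p0) big_ord_recr /= coef_map mulrDl mulfK ?expf_neq0 // addrC.
  apply: (unit_addN hA); first by apply: const_unit; rewrite -lead_coefE lead_coef_eq0.
  rewrite mulr_suml; apply: (nonunit_sum hA) => i _; rewrite coef_map /=.
  have -> : tvar K ^+ (size p).-1 = tvar K ^+ i * tvar K ^+ ((size p).-1 - i).-1.+1.
    by rewrite -exprD prednK ?subn_gt0 // subnKC // ltnW.
  rewrite cancel ?expf_neq0 // -exprVn exprS.
  by do 2!apply: (nonunitM hA) => //; apply: AX; case: Mt.
split=> //; [by left | by rewrite invr_eq0 |].
move=> f f0; have n0 := numerator_neq0 f0; have d0 := numden_neq0 f.
exists ((size \d_(repr f))%:Z - (size \n_(repr f))%:Z).
  by rewrite /v_infty (negPf f0).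
have predB (a b : nat) : (0 < a)%N -> (0 < b)%N -> a%:Z - b%:Z = a.-1%:Z - b.-1%:Z by lia.
rewrite predB ?size_poly_gt0 //.
rewrite in_algE expfzDr ?invr_eq0 // -invr_expz -!exprnP mulrC.
apply: (assocM hA); last by rewrite -exprVn invrK; apply: poly_assoc.
by rewrite exprVn; apply/(assocV (A := A))/poly_assoc.
Qed.

(** If [A] contains [t], then some [t - a] is a nonunit, for otherwise [A] would
contain [k(t)]. *)
Lemma restriction_to_ratfun : exists v t', represents v t'.
Proof.
have [At|nAt] := pselect (A (tvar K)); last first.
  by exists (@v_infty k), (tvar K)^-1; apply: represents_infinite.
have [[a Ma]|noa] := pselect (exists a, nonunit A (poly_in K ('X - a%:P))).
  by exists (v_at a), (poly_in K ('X - a%:P)); apply: represents_finite.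
have pu p : p != 0 -> ring_unit A (poly_in K p).
  move=> p0; have [s _ ->] := closed_factors p0; rewrite -mul_polyC rmorphM.
  apply: (unitM hA); first by apply: const_unit; rewrite lead_coef_eq0.
  elim: s => [|a s IH]; first by rewrite big_nil rmorph1; apply: unit1 hA.
  rewrite big_cons rmorphM; apply: (unitM hA) => //.
  have [//|Ma] := unit_or_nonunit (poly_in_ring ('X - a%:P) At).
  by case: noa; exists a.
case: ring_not_over_ratfun => f; rewrite in_algE.
by apply: AM; [apply: poly_in_ring | case: (pu _ (numden_neq0 f))].
Qed.

End ValuationRingOfFunctionField.

Section DiscreteValuation.
Variables (k : closedFieldType) (K : fieldExtType (ratfun k)) (A : set K).
Variables (v : ratfun k -> \bar int) (t' : K).
Hypotheses (hA : valuation_ring A) (rep : represents A v t').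

Let A1 : A 1. Proof. by case: hA. Qed.
Let AB x y : A x -> A y -> A (x - y). Proof. by case: hA => _ + _ _; apply. Qed.
Let AM x y : A x -> A y -> A (x * y). Proof. by case: hA => _ _ + _; apply. Qed.
Let Atot x : A x \/ A x^-1. Proof. by case: hA. Qed.
Let AX x n : A x -> A (x ^+ n). Proof. exact: (subringX A1 AM). Qed.
Let t0 : t' != 0. Proof. by case: rep. Qed.
Let Mt : nonunit A t'. Proof. by case: rep. Qed.
Let At : A t'. Proof. by case: Mt. Qed.
Local Notation N := (\dim {:K}).

(** More than [N] elements are linearly dependent over [k(t)], and two terms of
a dependency have the same value. Hence the value group of [k(t)] has index at
most [N] in that of [K]. *)
Lemma value_index n (x : 'I_n -> K) : (N < n)%N -> (forall i, x i != 0) ->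
  exists i j, i != j /\ exists m : int, assoc A (x i) (x j * t' ^ m).
Proof.
move=> Nn x0.
have [|c [i0 ci0] cE] := @linear_relation (ratfun k) 'I_n 'I_N
   (fun i l => coord (vbasis {:K}) l (x i)); first by rewrite !card_ord.
have [|||i [j [ci cj ij Tij]]] := @vanishing_sum_assoc _ _ hA 'I_n
    (fun i => (c i)%:A * x i) (fun i => c i != 0).
- by exists i0.
- by move=> i ci; rewrite mulf_neq0 // (fmorph_eq0 (in_alg K)).
- rewrite big_mkcond /= (eq_bigr (fun i => c i *: x i)) => [|i _]; last first.
    by rewrite mulr_algl; case: eqVneq => [->|]; rewrite ?scale0r.
  under eq_bigr => i _ do rewrite (coord_vbasis (memvf (x i))) scaler_sumr.
  rewrite exchange_big big1 //= => l _.
  by under eq_bigr => i _ do rewrite scalerA; rewrite -scaler_suml cE scale0r.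
exists i, j; split=> //; have [_ _ _ repf] := rep.
have [a _ ai] := repf _ ci; have [b _ bj] := repf _ cj; exists (b - a).
have step l d : assoc A (c l)%:A (t' ^ d) -> assoc A ((c l)%:A * x l) (t' ^ d * x l).
  by move=> cl; apply: (assocM hA) => //; apply/(assoc_refl hA)/x0.
have ta := expfz_neq0 (- a) t0.
have := assoc_trans hA (assoc_sym (step _ _ ai)) (assoc_trans hA Tij (step _ _ bj)).
move=> /(assocM hA (assoc_refl hA ta)); rewrite !mulrA -!expfzDr //.
by rewrite addrC subrr expr0z mul1r [X in _ -> assoc _ _ X]mulrC addrC.
Qed.

Let assoc_swap (x y : K) (m : int) : assoc A x (y * t' ^ m) -> assoc A y (x * t' ^ (- m)).
Proof.
by move=> /assoc_sym; rewrite /assoc -invr_expz invfM invrK mulrA mulrAC.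
Qed.

(** The values of such a sequence would lie strictly between those of [1] and
[t'], hence be pairwise incongruent modulo the value of [t'], contradicting
[value_index]. *)
Let no_chain (y : nat -> K) : y 0%N = t' -> (forall i, y i != 0 /\ A (y i)) ->
  ~ forall i, nonunit A (y i / y i.+1).
Proof.
move=> yt yA Mi.
have y0 i : y i != 0 by case: (yA i).
have Mab a b : (a < b)%N -> nonunit A (y a / y b).
  elim: b => // b IH; rewrite ltnS leq_eqVlt => /orP[/eqP-> //|/IH Mb].
  have -> : y a / y b.+1 = y a / y b * (y b / y b.+1) by rewrite mulrA divfK.
  by apply: (nonunitM hA) => //; case: (Mi b).
suff absurd i j (m : int) : (i < j)%N -> ~ assoc A (y i.+1) (y j.+1 * t' ^ m).
  have [//|i|i [j [ij [m yij]]]] := @value_index N.+1 (fun i : 'I_N.+1 => y i.+1).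
    by case: (yA i.+1).
  have [ij'|ji|/val_inj e] := ltngtP i j; last by rewrite e eqxx in ij.
    exact: absurd yij.
  by apply: (absurd _ _ (- m) ji); apply: assoc_swap.
move=> ij yij; have Mr : nonunit A (y i.+1 / y j.+1) by apply: Mab.
have r0 : y i.+1 / y j.+1 != 0 by rewrite mulf_neq0 ?invr_eq0.
have rt : assoc A (y i.+1 / y j.+1) (t' ^ m) by move: yij; rewrite /assoc invfM mulrA.
have [m0|m0] := lerP m 0.
  apply: (nonunit_inv Mr r0); apply: (assoc_in hA (assocV rt)).
  by rewrite invr_expz; apply: (ring_exp_ge0 hA) => //; rewrite oppr_ge0.
have Mti : nonunit A (t' / y i.+1) by rewrite -yt; apply: Mab.
apply: (nonunit_inv Mti); first by rewrite mulf_neq0 ?invr_eq0.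
rewrite invf_div -[y i.+1](divfK (y0 j.+1)) mulrAC; apply: AM; last by case: (yA j.+1).
apply: (assoc_in hA (assocM hA rt (assoc_refl hA (invr_neq0 t0)))).
by rewrite -[t'^-1]/(t' ^ (-1)) -expfzDr //; apply: (ring_exp_ge0 hA) => //; lia.
Qed.

(** If every nonunit had a proper divisor that is a nonunit, iterating from [t']
would produce a sequence excluded by [no_chain]. *)
Lemma ring_uniformizer : exists p, [/\ nonunit A p, p != 0 & forall y, nonunit A y -> A (y / p)].
Proof.
apply: contrapT => nop.
have /choice[f fP] (p : K) : exists y, nonunit A p /\ p != 0 ->
    [/\ nonunit A y, y != 0 & nonunit A (p / y)].
  have [[Mp p0]|] := pselect (nonunit A p /\ p != 0); last by exists 0.
  have [y My nAy] : exists2 y, nonunit A y & ~ A (y / p).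
    apply: contrapT => h; apply: nop; exists p; split=> // y My.
    by apply: contrapT => nAy; apply: h; exists y.
  exists y => _; split=> //; last by rewrite -invf_div; apply: nonunitV.
  by apply: contra_notN nAy => /eqP->; rewrite mul0r; apply: (subring0 A1 AB).
have yP i : nonunit A (iter i f t') /\ iter i f t' != 0.
  by elim: i => [|i /fP[]].
apply: (@no_chain (fun i => iter i f t')) => // i; last by case: (fP _ (yP i)).
by case: (yP i) => -[].
Qed.

(** The ring [A] is a discrete valuation ring. The powers of [p] that divide
[t'] are bounded by [no_chain], and those that divide any other element because
one of its powers is associate to a power of [t'], by [value_index]. *)
Lemma ring_valuation : exists p (e : nat), [/\ nonunit A p, p != 0, (0 < e)%N,
  assoc A t' (p ^+ e) & forall x, x != 0 -> exists m : int, assoc A x (p ^ m)].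
Proof.
have [p [Mp p0 pmin]] := ring_uniformizer.
have Ap : A p by case: Mp.
have first_fail x : A x -> x != 0 -> ~ (forall n, A (x / p ^+ n)) -> exists n, assoc A x (p ^+ n).
  move=> Ax x0 /existsNP[n0 nAn0].
  have ex : exists n, `[< ~ A (x / p ^+ n) >] by exists n0; apply/asboolP.
  case: (ex_minnP ex) => -[|n] /asboolP nAn nmin; first by case: nAn; rewrite expr0 divr1.
  exists n; have An : A (x / p ^+ n).
    by apply: contrapT => h; have := nmin n (asboolT h); rewrite ltnn.
  have [//|/pmin] := unit_or_nonunit An.
  by rewrite -mulrA -invfM -exprSr.
have [e te] : exists e, assoc A t' (p ^+ e).
  apply: first_fail => // At'; apply: (@no_chain (fun i => t' / p ^+ i)).
  - by rewrite expr0 divr1.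
  - by move=> i; split=> //; rewrite mulf_neq0 ?invr_eq0 ?expf_neq0.
  move=> i; suff -> : t' / p ^+ i / (t' / p ^+ i.+1) = p by [].
  rewrite invf_div exprS mulf_div mulrCA [_ ^+ i * t']mulrC mulfK //.
  by rewrite mulf_neq0 ?expf_neq0.
exists p, e; split=> //.
  case: e te => // /assoc_sym; rewrite expr0 /assoc div1r => /unitV.
  by rewrite invrK => ut; case: Mt => _ [].
move=> x x0; wlog Ax : x x0 / A x.
  move=> W; have [/W h|AV] := Atot x; first exact: h.
  have [|m xm] := W x^-1 _ AV; first by rewrite invr_eq0.
  by exists (- m); rewrite -invr_expz -[x]invrK; apply: assocV.
suff [n xn] : exists n, assoc A x (p ^+ n) by exists n; rewrite -exprnP.
apply: first_fail => // Axn.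
have [//|i|i [j [ij [m xij]]]] := @value_index N.+1 (fun i : 'I_N.+1 => x ^+ i).
  exact: expf_neq0.
have [d d0 [m' xd]] : exists2 d, (0 < d)%N & exists m, assoc A (x ^+ d) (t' ^ m).
  move: xij; have sub (a b : nat) c : (a < b)%N -> assoc A (x ^+ b) (x ^+ a * t' ^ c) ->
      assoc A (x ^+ (b - a)) (t' ^ c).
    move=> /ltnW ab; rewrite /assoc -{1}(subnK ab) exprD.
    by rewrite invfM mulrA mulfK ?expf_neq0.
  have [ij'|ji|/val_inj eij] := ltngtP i j; last by rewrite eij eqxx in ij.
    move=> /assoc_swap h; exists (j - i)%N; first by rewrite subn_gt0.
    by exists (- m); apply: sub.
  by move=> h; exists (i - j)%N; [rewrite subn_gt0 | exists m; apply: sub].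
have xp : assoc A (x ^+ d) (p ^ (e%:Z * m')).
  by apply: (assoc_trans hA xd); rewrite -exprz_exp -exprnP; apply: (assocX hA).
pose n := `|e%:Z * m'|.+1.
suff /(nonunit_exp_ge0 hA Mp p0) : A (p ^ (e%:Z * m' - (n * d)%N%:Z)).
  by have := leq_pmulr n d0; lia.
rewrite expfzDr // -invr_expz -exprnP exprM.
apply: (assoc_in hA (assocM hA (assoc_sym xp) (assoc_refl hA _))).
  by rewrite invr_eq0 !expf_neq0.
by rewrite -exprVn -exprMn; apply: AX.
Qed.

End DiscreteValuation.

Lemma ratfun_place0 (k : fieldType) (v : ratfun k -> \bar int) :
  ratfun_places v -> v 0 = +oo%E.
Proof. by move=> [->|[a ->]]; rewrite /v_infty /v_at eqxx. Qed.

(** The place is the exponent of [p] in [ring_valuation], and the ramification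
index the exponent of [p] in [t']. *)
Lemma place_of_valuation_ring (k : closedFieldType) (K : fieldExtType (ratfun k)) (A : set K)
    (v : ratfun k -> \bar int) (t' : K) :
  valuation_ring A -> represents A v t' ->
  exists2 w, places w & forall x, val_ge w 0 x -> A x.
Proof.
move=> hA rep; have [p [e [Mp p0 e0 te xp]]] := ring_valuation hA rep.
have /choice[ord ordP] x : exists m : int, x != 0 -> assoc A x (p ^ m).
  by case: (eqVneq x 0) => [_|/xp[m xm]]; [exists 0 | exists m].
have ordE x m : x != 0 -> A (x / p ^ m) <-> m <= ord x.
  move=> x0; rewrite -[m <= _]subr_ge0.
  have xm : assoc A (x / p ^ m) (p ^ (ord x - m)).
    rewrite expfzDr // -invr_expz; apply: (assocM hA (ordP x x0)).
    by apply/(assoc_refl hA); rewrite invr_eq0 expfz_neq0.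
  split=> [Am|m0]; last by apply: (assoc_in hA xm); apply: (ring_exp_ge0 hA) => //; case: Mp.
  by apply: (nonunit_exp_ge0 hA Mp p0); apply: (assoc_in hA (assoc_sym xm)).
have ord_unique x m : assoc A x (p ^ m) -> ord x = m.
  move=> xm; have [x0 pm0] := assoc_neq0 xm; apply/eqP; rewrite eq_le; apply/andP; split.
    have [_ h _] := assoc_trans hA (assoc_sym xm) (ordP x x0).
    by rewrite -subr_ge0; apply: (nonunit_exp_ge0 hA Mp p0); rewrite expfzDr // -invr_expz.
  by apply/ordE => //; case: xm.
pose w x : \bar int := if x == 0 then +oo%E else (ord x)%:E.
have wE x : x != 0 -> w x = (ord x)%:E by rewrite /w => /negPf->.
have w0 : w 0 = +oo%E by rewrite /w eqxx.
have wN x : w x != -oo%E by rewrite /w; case: (x == 0).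
have nw : normalized_valuation w.
  split=> //.
  - apply/seteqP; split=> [_ [x /= x0 <-]|_ [m _ <-]]; first by exists (ord x); rewrite // wE.
    exists (p ^ m); rewrite /= ?expfz_neq0 // wE ?expfz_neq0 //; congr (_%:E).
    by apply/ord_unique/(assoc_refl hA)/expfz_neq0.
  - move=> x y; have [->|x0] := eqVneq x 0; first by rewrite mul0r w0 addye.
    have [->|y0] := eqVneq y 0; first by rewrite mulr0 w0 addey.
    rewrite !wE ?mulf_neq0 // -EFinD; congr (_%:E); apply: ord_unique.
    by rewrite expfzDr //; apply: (assocM hA); apply: ordP.
  move=> x y; have [xy0|xy0] := eqVneq (x + y) 0; first by rewrite xy0 w0 leey.
  have [x0|x0] := eqVneq x 0; first by rewrite x0 add0r ge_min lexx orbT.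
  have [y0|y0] := eqVneq y 0; first by rewrite y0 addr0 ge_min lexx.
  rewrite !wE // -EFin_min lee_fin; apply/ordE => //; rewrite mulrDl.
  have [A1 AB _ _] := hA; apply: (subringD A1 AB).
    by apply/ordE; rewrite // ge_min lexx.
  by apply/ordE; rewrite // ge_min lexx orbT.
exists w.
  split=> //; have [pv _ _ repf] := rep; exists v => //; exists e => // a.
  have [->|a0] := eqVneq a 0.
    by rewrite scale0r w0 (ratfun_place0 pv) gt0_muley // lte_fin ltz_nat.
  have [n -> an] := repf a a0; rewrite wE; last by case/assoc_neq0: an.
  rewrite -EFinM; congr (_%:E); apply: ord_unique; apply: (assoc_trans hA an).
  by rewrite -exprz_exp -exprnP; apply: (assocX hA).
move=> x; have [->|x0] := eqVneq x 0; first by have [A1 AB _ _] := hA; move=> _;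
  apply: (subring0 A1 AB).
by rewrite /val_ge wE // lee_fin; have := ordE x 0 x0; rewrite expr0z divr1 => -[].
Qed.

(** The valuation ring of a pole of [z] is obtained by extending [k[1/z]] as far
as possible without [z]. *)
Lemma exists_pole (k : closedFieldType) (K : fieldExtType (ratfun k)) (z : K) :
  (forall c, z != const_in K c) -> exists2 w, places w & ~ val_ge w 0 z.
Proof.
move=> zc; have [A [hA Ac Az]] := valuation_ring_over_constants zc.
have [v [t' rep]] := restriction_to_ratfun hA Ac Az.
have [w pw wA] := place_of_valuation_ring hA rep.
by exists w => // /wA.
Qed.

(** * Riemann's inequality *)

Section Divisors.
Variables (k : closedFieldType) (K : fieldExtType (ratfun k)).
Local Notation N := (\dim {:K}).

(** The list [s] stands for the effective divisor in which a place counts as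
often as it occurs in [s]; this is the Riemann-Roch space of [s]. *)
Definition bounded_by (s : seq (K -> \bar int)) (x : K) : Prop :=
  forall w, places w -> val_ge w (- (count_mem w s)%:Z) x.

Definition const_free (I : finType) (e : I -> K) : Prop :=
  forall u : I -> k, \sum_i const_in K (u i) * e i = 0 -> forall i, u i = 0.

Lemma bounded_by_nil x : bounded_by [::] x -> exists c, x = const_in K c.
Proof.
move=> hx; apply: contrapT => /forallNP nc.
have [|w pw] := @exists_pole k K x; first by move=> c; apply/negP => /eqP; apply: nc.
by apply; have := hx w pw; rewrite oppr0.
Qed.

Lemma val_ge_step (w : K -> \bar int) (m : int) (x : K) : places w ->
  val_ge w m x -> val_ge w (m + 1) x \/ w x = m%:E.
Proof.
move=> [hw _] hx; have [->|x0] := eqVneq x 0; first by left; apply: val_ge0.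
have [n wn] := val_fin hw x0; move: hx; rewrite /val_ge wn !lee_fin => mn.
by have [->|nm] := eqVneq n m; [right | left; lia].
Qed.

(** Imposing one more zero at a place costs at most one dimension, since the
residue field is [k]; without poles only constants are left. *)
Lemma dim_bounded_by_ord (s : seq (K -> \bar int)) n (e : 'I_n -> K) :
  (forall i, bounded_by s (e i)) -> const_free e -> (n <= (size s).+1)%N.
Proof.
elim: s n e => [|w s IH] n e eb fe.
  have /choice[c cE] i := bounded_by_nil (eb i).
  rewrite leqNgt; apply/negP => n1.
  have [|u [i ui] uE] := @linear_relation k 'I_n 'I_1 (fun i _ => c i).
    by rewrite !card_ord.
  move/eqP: ui; apply; apply: (fe u).
  under eq_bigr => j _ do rewrite cE -rmorphM.
  by rewrite -rmorph_sum (uE 0) rmorph0.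
have other w' x : w' != w -> val_ge w' (- (count_mem w' (w :: s))%:Z) x ->
    val_ge w' (- (count_mem w' s)%:Z) x.
  by move=> w'w; rewrite /= [w == _]eq_sym (negPf w'w).
have [all_in|/existsNP[i0 ei0]] := pselect (forall i, bounded_by s (e i)).
  exact: leq_trans (IH _ _ all_in fe) _.
have pw : places w.
  apply: contrapT => nw; apply: ei0 => w' pw'; apply: other (eb i0 w' pw').
  by apply/eqP => w'w; rewrite w'w in pw'.
have [hw _] := pw.
have cw : (- (count_mem w (w :: s))%:Z + 1 = - (count_mem w s)%:Z).
  by rewrite /= eqxx; lia.
have we0 : w (e i0) = (- (count_mem w (w :: s))%:Z)%:E.
  have [h|//] := val_ge_step pw (eb i0 w pw); case: ei0 => w' pw'.
  have [->|w'w] := eqVneq w' w; first by rewrite -cw.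
  exact: other (eb i0 w' pw').
have e00 : e i0 != 0 by apply: contra_eq_neq we0 => ->; rewrite (valuation0 hw).
case: n i0 e eb fe {ei0} we0 e00 => [[]//|n] i0 e eb fe we0 e00.
have /choice[c cP] i : exists c, val_ge w (- (count_mem w s)%:Z) (e i - const_in K c * e i0).
  have h : val_ge w 0 (e i / e i0).
    apply: (val_ge_divl hw e00 we0); rewrite add0r mulrC divfK //; exact: eb.
  have [c cP] := residue hw h; exists c.
  have h0 : val_ge w (- (count_mem w (w :: s))%:Z) (e i0) by rewrite /val_ge we0.
  by have := val_geM hw cP h0; rewrite mulrBl divfK // -cw addrC.
rewrite ltnS; apply: (IH n (fun j => e (lift i0 j) - const_in K (c (lift i0 j)) * e i0)).
  move=> j w' pw'; have [->|w'w] := eqVneq w' w; first exact: cP.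
  have [hw' _] := pw'; apply: other => //; apply: (val_geD hw'); first exact: eb.
  apply: (val_geN hw'); rewrite -[- _]add0r; apply: (val_geM hw'); last exact: eb.
  exact: val_ge_const.
move=> u uE j.
pose u' i := if unlift i0 i is Some j then u j else - \sum_j u j * c (lift i0 j).
suff /fe/(_ (lift i0 j)) : \sum_i const_in K (u' i) * e i = 0 by rewrite /u' liftK.
rewrite (bigD1_ord i0) //= {1}/u' unlift_none rmorphN rmorph_sum mulNr mulr_suml -sumrN.
rewrite -big_split /= -[RHS]uE; apply: eq_bigr => i _.
by rewrite /u' liftK mulrBr rmorphM mulrA addrC.
Qed.

Lemma dim_bounded_by (s : seq (K -> \bar int)) (I : finType) (e : I -> K) :
  (forall i, bounded_by s (e i)) -> const_free e -> (#|I| <= (size s).+1)%N.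
Proof.
move=> eb fe; apply: (@dim_bounded_by_ord s _ (e \o enum_val)) => [i|u uE i].
  exact: eb.
rewrite -(enum_valK i); apply: (fe (u \o enum_rank)).
rewrite (reindex _ (onW_bij _ (enum_val_bij I))) /= -[RHS]uE.
by apply: eq_bigr => l _; rewrite enum_valK.
Qed.

Definition multiple (m : nat) (s : seq (K -> \bar int)) := flatten (nseq m s).

Lemma count_multiple m s w : count_mem w (multiple m s) = (m * count_mem w s)%N.
Proof. by rewrite count_flatten map_nseq sumn_nseq mulnC. Qed.

Lemma size_multiple m s : size (multiple m s) = (m * size s)%N.
Proof. by rewrite size_flatten /shape map_nseq sumn_nseq mulnC. Qed.

End Divisors.

Section Degree.
Variables (k : closedFieldType) (K : fieldExtType (ratfun k)) (s : seq (K -> \bar int)).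
Local Notation N := (\dim {:K}).
Local Notation e := (vbasis {:K}).
Local Notation bnd m := (bounded_by (multiple m s)).

Lemma bounded_by_multipleW m n x : (m <= n)%N -> bnd m x -> bnd n x.
Proof.
move=> mn hx w pw; have [hw _] := pw; apply: val_geW (hx w pw).
by rewrite !count_multiple lerN2 lez_nat leq_mul2r mn orbT.
Qed.

Lemma bounded_by_multiple1 x : bounded_by s x -> bnd 1 x.
Proof. by move=> hx w pw; rewrite count_multiple mul1n; apply: hx. Qed.

Lemma bounded_byM m n x y : bnd m x -> bnd n y -> bnd (m + n) (x * y).
Proof.
move=> hx hy w pw; have [hw _] := pw.
by rewrite count_multiple mulnDl PoszD opprD -!count_multiple;
  apply: val_geM; [|exact: hx|exact: hy].
Qed.

Lemma bounded_byX m n x : bnd m x -> bnd (m * n) (x ^+ n).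
Proof.
move=> hx; elim: n => [|n IH]; last by rewrite exprS mulnS; apply: bounded_byM.
by move=> w [hw _]; rewrite muln0; apply: val_ge1.
Qed.

Lemma bounded_by_sum I (r : seq I) (P : pred I) (F : I -> K) m :
  (forall i, P i -> bnd m (F i)) -> bnd m (\sum_(i <- r | P i) F i).
Proof. by move=> h w pw; have [hw _] := pw; apply: (val_ge_sum hw) => i /h; apply. Qed.

Lemma bounded_by_prod I (r : seq I) (F : I -> K) m :
  (forall i, bnd m (F i)) -> bnd (m * size r) (\prod_(i <- r) F i).
Proof.
move=> h; elim: r => [|i r IH]; last by rewrite big_cons mulnS; apply: bounded_byM.
by rewrite big_nil muln0 => w [hw _]; apply: val_ge1.
Qed.

Lemma bounded_by_const m c : bnd m (const_in K c).
Proof.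
move=> w [hw _]; apply: (val_geW _ (val_ge_const hw c)).
by rewrite oppr_le0.
Qed.

Lemma bounded_by_poly m (p : {poly k}) z :
  bnd m z -> bnd (m * size p) (map_poly (const_in K) p).[z].
Proof.
move=> hz; rewrite horner_coef; apply: bounded_by_sum => i _.
rewrite coef_map -[(m * _)%N]add0n; apply: bounded_byM; first exact: bounded_by_const.
apply: bounded_by_multipleW (bounded_byX i hz).
by rewrite leq_mul2l (leq_trans (ltnW (ltn_ord i))) ?orbT // size_poly.
Qed.

Lemma bounded_by_lead_root (F : {poly K}) b m :
  (forall i, bnd m F`_i) -> root F b -> bnd m (lead_coef F * b).
Proof.
by move=> hF Fb w pw; have [hw _] := pw; apply: (val_ge_lead_root hw) => // i; apply: hF.
Qed.

Lemma tvar_nonconst c : tvar K != const_in K c.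
Proof.
by rewrite -subr_eq0 -rmorphB poly_in_eq0 polyXsubC_eq0.
Qed.

(** A basis of [K] over [k(t)] whose elements have poles only where [z] has. The
field [K] is algebraic over [k(z)]; clearing the leading coefficients of the
equations of the basis elements over [k[z]] leaves them integral over [k[z]]. *)
Lemma bounded_basis (z : K) m : (forall c, z != const_in K c) -> bnd m z ->
  exists2 L : K, L != 0 & exists C, forall l : 'I_N, bnd C (L * e`_l).
Proof.
move=> zc hz.
have /choice[F FP] (l : 'I_N) : exists F : {poly {poly k}}, F != 0 /\
    (map_poly (fun p => (map_poly (const_in K) p).[z]) F).[e`_l] = 0.
  by have [F F0 Fe] := algebraic_over_transcendental e`_l zc; exists F.
pose ev (p : {poly k}) : K := (map_poly (const_in K) p).[z].
have ev0 p : (ev p == 0) = (p == 0).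
  have [->|p0] := eqVneq p 0; first by rewrite /ev rmorph0 horner0 eqxx.
  exact/negbTE/transcendental.
pose H l : {poly K} := map_poly ev (F l).
have evr0 : ev 0 = 0 by apply/eqP; rewrite ev0.
have Hc l i : (H l)`_i = ev (F l)`_i by apply: coef_map_id0.
have H0 l : lead_coef (H l) != 0.
  rewrite lead_coef_eq0; have [F0 _] := FP l; apply: contra_neq F0 => HE.
  by apply/polyP => i; apply/eqP; rewrite coef0 -ev0 -Hc HE coef0.
pose d (l : 'I_N) (i : nat) : nat := size (F l)`_i.
pose S := \max_l \max_(i < size (F l)) d l i.
have HS l i : bnd (m * S) (H l)`_i.
  rewrite Hc; apply: bounded_by_multipleW (bounded_by_poly _ hz).
  rewrite leq_mul2l; apply/orP; right.
  have [iF|iF] := ltnP i (size (F l)); last by rewrite nth_default // size_poly0.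
  apply: leq_trans (leq_bigmax l).
  exact: (@leq_bigmax _ (fun i : 'I_(size (F l)) => d l i) (Ordinal iF)).
exists (\prod_l lead_coef (H l)); first by apply/prodf_neq0 => l _; apply: H0.
exists (m * S * size (index_enum 'I_N) + m * S)%N => l.
rewrite (bigD1 l) //= mulrAC mulrC; apply: bounded_byM.
  rewrite -big_filter.
  apply: (@bounded_by_multipleW (m * S * size [seq j <- index_enum 'I_N | j != l])).
    by rewrite leq_mul2l size_filter count_size orbT.
  by apply: bounded_by_prod => j; apply: HS.
by apply: bounded_by_lead_root => //; have [_ /eqP] := FP l.
Qed.

(** If [l0] is the leading coefficient of [G], then neither [l0] nor [l0 * t] has
more poles than [s]. So the products [(l0 t)^a l0^(r-a) b_i], where the [b_i]
form a basis as in [bounded_basis], live in a space of dimension about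
[r * size s] by Riemann's inequality; and there are [(r + 1) * N] of them, which
are linearly independent over [k]. *)
Lemma degree_le_of_root (G : {poly K}) : G != 0 -> root G (tvar K) ->
  (forall i, bounded_by s G`_i) -> (N <= size s)%N.
Proof.
move=> G0 Gt Gb; have Gb1 i : bnd 1 G`_i by apply: bounded_by_multiple1.
(* A polynomial with constant coefficients does not vanish at [t]. *)
have [i0 zc] : exists i, forall c, G`_i != const_in K c.
  apply: contrapT => /forallNP nc.
  have /choice[g gE] i : exists c, G`_i = const_in K c.
    by apply: contrapT => /forallNP h; apply: (nc i) => c; apply/negP => /eqP; apply: h.
  pose g' : {poly k} := \poly_(i < size G) g i.
  have gG : map_poly (const_in K) g' = G.
    apply/polyP => i; rewrite coef_map coef_poly; case: ltnP => [_|iG]; first by rewrite gE.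
    by rewrite [RHS]nth_default //= rmorph0.
  have g0 : g' != 0 by apply: contra_neq G0 => g0; rewrite -gG g0 rmorph0.
  by have := transcendental tvar_nonconst g0; rewrite gG (eqP Gt) eqxx.
have [L L0 [C LC]] := bounded_basis zc (Gb1 i0).
rewrite leqNgt; apply/negP => sN.
pose l0 := lead_coef G; have l00 : l0 != 0 by rewrite lead_coef_eq0.
(* With this [r], the inequality [(r + 1) * N <= (r + C) * (N - 1) + 1] fails. *)
pose r := (C * N).+1.
pose f (ai : 'I_r.+1 * 'I_N) := (l0 * tvar K) ^+ ai.1 * l0 ^+ (r - ai.1) * (L * e`_ai.2).
have fb ai : bounded_by (multiple (r + C) s) (f ai).
  apply: bounded_byM; last exact: LC.
  rewrite -{1}(subnKC (leq_ord ai.1)); apply: bounded_byM.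
    by rewrite -[X in bnd X]mul1n; apply/bounded_byX/bounded_by_lead_root.
  by rewrite -[X in bnd X]mul1n; apply/bounded_byX/Gb1.
suff /(dim_bounded_by fb) : const_free f.
  rewrite card_prod !card_ord size_multiple => h.
  have : (r.+1 * N <= ((r + C) * N.-1).+1)%N.
    by rewrite (leq_trans h) // ltnS leq_mul2l -ltnS prednK ?sN ?orbT // (leq_ltn_trans _ sN).
  move: sN; rewrite /r; case: N => // n _; nia.
move=> u uE.
have regroup (x y L' c y' z : K) : x * y * L' * (c * y' * z) = c * (x * y' * y * (L' * z)).
  by ring.
pose P (i : 'I_N) : {poly k} := \sum_(a < r.+1) u (a, i) *: 'X^a.
have Pc (a : 'I_r.+1) i : (P i)`_a = u (a, i).
  rewrite coef_sum (bigD1 a) //= big1 ?addr0 ?coefZ ?coefXn ?eqxx ?mulr1 //.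
  by move=> b ba; rewrite coefZ coefXn eq_sym (inj_eq val_inj) (negPf ba) mulr0.
have PE : \sum_i (P i)%:F *: e`_i = 0.
  have {}uE : \sum_a \sum_i const_in K (u (a, i)) * f (a, i) = 0.
    by rewrite pair_bigA -[RHS]uE; apply: eq_bigr => -[].
  apply: (mulfI (mulf_neq0 (expf_neq0 r l00) L0)).
  rewrite mulr0 -[RHS]uE [RHS]exchange_big /=.
  rewrite mulr_sumr; apply: eq_bigr => i _.
  rewrite -mulr_algl -[_%:A]/(poly_in K (P i)) rmorph_sum mulr_suml mulr_sumr.
  apply: eq_bigr => a _; rewrite /f -mul_polyC rmorphM rmorphXn exprMn /=.
  have -> : l0 ^+ r = l0 ^+ a * l0 ^+ (r - a) by rewrite -exprD subnKC ?leq_ord.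
  exact: regroup.
have /freeP/(_ (fun i => (P i)%:F) PE) P0 := basis_free (vbasisP {:K}).
move=> [a i]; have /eqP := P0 i; rewrite tofrac_eq0 => /eqP Pi.
by rewrite -Pc Pi coef0.
Qed.

End Degree.

(** * Multiplication matrices *)

Section StableSpan.
Variables (F E : fieldType) (phi : {rmorphism F -> E}).
Hypothesis alg : forall x : E, algebraicOver phi x.

Lemma power_reduction (c : E) : exists2 d, (0 < d)%N & exists B : nat -> 'I_d -> F,
  forall a, c ^+ a = \sum_l phi (B a l) * c ^+ l.
Proof.
have [p pm pc] := (integral_algebraic phi c).1 (alg c).
have p2 : (1 < size p)%N.
  rewrite ltnNge; apply/negP => /size1_polyC pE.
  by move: pc pm; rewrite pE map_polyC /root hornerC fmorph_eq0 monicE lead_coefC => /eqP->;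
    rewrite eq_sym oner_eq0.
have p0 : (0 < size p)%N by apply: ltn_trans p2.
exists (size p).-1; first by rewrite -ltnS prednK.
exists (fun a l => ('X^a %% p)`_l) => a.
have sz : (size (map_poly phi ('X^a %% p)) <= (size p).-1)%N.
  rewrite size_map_poly -ltnS prednK // ltn_modp.
  exact: monic_neq0.
have := congr1 (fun q => (map_poly phi q).[c]) (divp_eq 'X^a p).
rewrite /= rmorphD rmorphM /= map_polyXn hornerXn hornerD hornerM (eqP pc) mulr0 add0r.
by rewrite (horner_coef_wide _ sz) => ->; apply: eq_bigr => l _; rewrite coef_map.
Qed.

(** The products of bounded powers of the [c]'s span a space that is stable
under multiplication by each of them. *)
Lemma stable_family (cs : seq E) : exists (I : finType) (b : I -> E), (exists i, b i != 0) /\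
  forall c, c \in cs -> exists A : I -> I -> F, forall i, \sum_l phi (A i l) * b l = c * b i.
Proof.
elim: cs => [|c cs [I [b [[i0 b0] IH]]]].
  by exists unit, (fun => 1); split=> //; exists tt; apply: oner_neq0.
have [d d0 [B BE]] := power_reduction c.
exists (I * 'I_d)%type, (fun ia : I * 'I_d => b ia.1 * c ^+ ia.2); split.
  by exists (i0, Ordinal d0); rewrite mulr1.
move=> c'; rewrite inE => /orP[/eqP->|c'cs].
  exists (fun ia la : I * 'I_d => (ia.1 == la.1)%:R * B ia.2.+1 la.2) => -[i a] /=.
  rewrite -(pair_bigA _ (fun l (a' : 'I_d) => phi ((i == l)%:R * B a.+1 a') * (b l * c ^+ a'))) /=.
  rewrite (bigD1 i) //= [X in _ + X]big1 ?addr0 => [|l li].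
    rewrite mulrCA -exprS BE mulr_sumr; apply: eq_bigr => a' _.
    by rewrite eqxx mul1r mulrCA.
  by rewrite big1 // => a' _; rewrite eq_sym (negPf li) mul0r rmorph0 mul0r.
have [A AE] := IH c' c'cs.
exists (fun ia la : I * 'I_d => A ia.1 la.1 * (ia.2 == la.2)%:R) => -[i a] /=.
rewrite -(pair_bigA _ (fun l (a' : 'I_d) => phi (A i l * (a == a')%:R) * (b l * c ^+ a'))) /=.
rewrite mulrA -AE mulr_suml; apply: eq_bigr => l _.
rewrite (bigD1 a) //= big1 ?addr0 => [|a' a'a].
  by rewrite eqxx mulr1 mulrA.
by rewrite eq_sym (negPf a'a) mulr0 rmorph0 mul0r.
Qed.

(** A common eigenvector of smallest possible size has linearly independent
entries, since an entry that depends on the others can be left out. *)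
Lemma stable_basis m (c : 'I_m -> E) : exists n (b : 'cV[E]_n) (A : 'I_m -> 'M[F]_n),
  [/\ b != 0, forall j, map_mx phi (A j) *m b = c j *: b &
      forall v : 'rV[F]_n, map_mx phi v *m b = 0 -> v = 0].
Proof.
pose P n := exists (b : 'cV[E]_n) (A : 'I_m -> 'M[F]_n),
  b != 0 /\ forall j, map_mx phi (A j) *m b = c j *: b.
have ex : exists n, `[< P n >].
  have [I [b [[i0 b0] bE]]] := stable_family [seq c j | j <- enum 'I_m].
  have /choice[A AE] j : exists A : I -> I -> F, forall i, \sum_l phi (A i l) * b l = c j * b i.
    by apply: bE; apply: map_f; rewrite mem_enum.
  exists #|I|; apply/asboolP; exists (\col_i b (enum_val i)).
  exists (fun j => \matrix_(i, l) A j (enum_val i) (enum_val l)); split.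
    apply/eqP => /matrixP/(_ (enum_rank i0) 0); rewrite !mxE enum_rankK => /eqP.
    by apply/negP.
  move=> j; apply/matrixP => i o; rewrite !mxE -AE.
  rewrite [RHS](reindex _ (onW_bij _ (enum_val_bij I))) /=.
  by apply: eq_bigr => l _; rewrite !mxE.
case: (ex_minnP ex) => n /asboolP[b [A [b0 bE]]] nmin.
exists n, b, A; split=> // v vb; apply: contrapT => /eqP/rV0Pn[i0 vi0].
case: n i0 b A b0 bE nmin v vb vi0 => [[]//|n] i0 b A b0 bE nmin v vb vi0.
pose R : 'M[F]_(n, n.+1) := \matrix_(l, i) (i == lift i0 l)%:R.
pose S : 'M[F]_(n.+1, n) := \matrix_(i, l)
  if unlift i0 i is Some i' then (i' == l)%:R else - v 0 (lift i0 l) / v 0 i0.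
have [b' b'R] : exists b' : 'cV[E]_n, b' = map_mx phi R *m b by eexists.
have b'E l : b' l 0 = b (lift i0 l) 0.
  rewrite b'R mxE (bigD1 (lift i0 l)) //= big1 ?addr0 => [|i il].
    by rewrite !mxE eqxx rmorph1 mul1r.
  by rewrite !mxE (negPf il) rmorph0 mul0r.
have bS : b = map_mx phi S *m b'.
  apply/matrixP => i o; rewrite ord1 mxE; have [l ->|->] := unliftP i0 i.
    rewrite (bigD1 l) //= big1 ?addr0 => [|l' ll'].
      by rewrite !mxE liftK eqxx rmorph1 mul1r b'E.
    by rewrite !mxE liftK eq_sym (negPf ll') rmorph0 mul0r.
  under eq_bigr => l _ do rewrite !mxE unlift_none b'E.
  move/matrixP/(_ 0 0): vb; rewrite !mxE (bigD1_ord i0) //= => /eqP.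
  rewrite addr_eq0 => /eqP vb.
  have phi0 : phi (v 0 i0) != 0 by rewrite fmorph_eq0.
  apply: (mulfI phi0); rewrite mxE in vb; rewrite vb mulr_sumr -sumrN.
  apply: eq_bigr => l _; rewrite mxE mulrA -mulNr; congr (_ * _).
  by rewrite -rmorphM mulrC divfK // rmorphN.
have /asboolT/nmin : P n; last by rewrite ltnn.
exists b', (fun j => R *m A j *m S); split.
  by apply: contra_neq b0 => b'0; rewrite bS b'0 mulmx0.
by move=> j; rewrite !map_mxM -!mulmxA -bS bE -scalemxAr b'R.
Qed.

End StableSpan.

(** * Linear equations with coefficients algebraic over k(t) *)

Section PolynomialReduction.
Variables (k : closedFieldType) (K : fieldExtType (ratfun k)).
Variables (w : K -> \bar int) (hw : normalized_valuation w).

Definition reduces_to (p : {poly K}) (q : {poly k}) : Prop :=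
  forall i, val_ge w 1 (p`_i - const_in K q`_i).

Lemma reduces_to_integral p q i : reduces_to p q -> val_ge w 0 p`_i.
Proof.
move=> pq; rewrite -(subrK (const_in K q`_i) p`_i); apply: (val_geD hw).
  by apply: val_geW (pq i).
exact: val_ge_const.
Qed.

Lemma reduces_to_sum I (r : seq I) (p : I -> {poly K}) (q : I -> {poly k}) :
  (forall i, reduces_to (p i) (q i)) -> reduces_to (\sum_(i <- r) p i) (\sum_(i <- r) q i).
Proof.
move=> pq i; rewrite !coef_sum rmorph_sum -sumrB.
by apply: (val_ge_sum hw) => j _; apply: pq.
Qed.

Lemma reduces_toM p q p' q' : reduces_to p q -> reduces_to p' q' -> reduces_to (p * p') (q * q').
Proof.
move=> pq pq' i; rewrite !coefM rmorph_sum -sumrB; apply: (val_ge_sum hw) => j _.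
rewrite rmorphM /=; set a := p`_j; set b := const_in K _; set a' := p'`_ _; set b' := const_in K _.
have -> : a * a' - b * b' = a * (a' - b') + (a - b) * b' by ring.
apply: (val_geD hw).
  by rewrite -[1]add0r; apply: (val_geM hw); [apply: reduces_to_integral pq | apply: pq'].
by rewrite -[1]addr0; apply: (val_geM hw); [apply: pq | apply: val_ge_const].
Qed.

Lemma reduces_to_map q : reduces_to (map_poly (const_in K) q) q.
Proof. by move=> i; rewrite coef_map subrr; apply: val_ge0. Qed.

Lemma reduces_to_det n (M : 'M[{poly K}]_n) (M' : 'M[{poly k}]_n) :
  (forall i j, reduces_to (M i j) (M' i j)) -> reduces_to (\det M) (\det M').
Proof.
move=> MM'; apply: reduces_to_sum => sigma; apply: reduces_toM.
  by rewrite -[(-1) ^+ _ as X in reduces_to X](rmorph_sign (map_poly (const_in K)));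
    apply: reduces_to_map.
elim: (index_enum _) => [|i r IH]; last by rewrite !big_cons; apply: reduces_toM.
by rewrite !big_nil -(rmorph1 (map_poly (const_in K))); apply: reduces_to_map.
Qed.

Lemma reduces_to_neq0 p q : reduces_to p q -> q != 0 -> p != 0.
Proof.
move=> pq; apply: contra_neq => p0; apply/polyP => i; rewrite coef0; apply/eqP.
apply: contraT => qi0; have := pq i; rewrite p0 coef0 sub0r => /(val_geN hw).
by rewrite opprK /val_ge (val_const hw).
Qed.

Lemma integral_elements_valuation_ring : valuation_ring [set x | val_ge w 0 x].
Proof.
split=> [|x y Ax Ay|x y Ax Ay|x]; first exact: val_ge1.
- by apply: (val_geD hw) => //; apply: (val_geN hw).
- by rewrite /= -[0]addr0; apply: (val_geM hw).
have [->|x0] := eqVneq x 0; first by left; apply: (val_ge0 hw).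
have [m wm] := val_fin hw x0; rewrite /= /val_ge (valV hw x0 wm) wm !lee_fin.
by case: (lerP 0 m) => m0; [left | right; rewrite oppr_ge0 ltW].
Qed.

End PolynomialReduction.

Section LinearEquation.
Variables (k : closedFieldType) (K : fieldExtType (ratfun k)) (m n : nat).
Variables (B : 'I_m -> 'M[{poly k}]_n).
Hypothesis B_regular : forall u : 'I_m -> k, (exists j, u j != 0) ->
  \det (\sum_j (u j)%:P *: B j) != 0.

(** When the [B j] are multiplication matrices this is the norm of the linear
form [sum_j c_j y_j] with coefficients algebraic over [k(t)], in which [t] is
kept as an indeterminate. *)
Definition norm_poly (y : 'I_m -> K) : {poly K} :=
  \det (\sum_j (y j)%:P *: map_mx (map_poly (const_in K)) (B j)).

Lemma norm_polyZ a y : norm_poly (fun j => a * y j) = a%:P ^+ n * norm_poly y.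
Proof.
rewrite /norm_poly -detZ scaler_sumr; congr (\det _); apply: eq_bigr => j _.
by rewrite scalerA polyCM.
Qed.

(** Choose a place, and [i] such that all ratios [y j / y i] are integral there.
Their residues are constants, not all zero, at which the norm form does not
vanish by assumption; and it reduces to its value there. *)
Lemma norm_poly_neq0 y : (exists j, y j != 0) -> norm_poly y != 0.
Proof.
move=> [j1 yj1]; have [w [hw _] _] := exists_pole (@tvar_nonconst k K).
have [||x] := exists_common_divisor (integral_elements_valuation_ring hw)
    (s := [seq y j | j <- enum 'I_m & y j != 0]).
- have : y j1 \in [seq y j | j <- enum 'I_m & y j != 0].
    by apply: map_f; rewrite mem_filter yj1 mem_enum.
  by case: [seq _ | _ <- _].
- by apply/allP => _ /mapP[j + ->]; rewrite mem_filter => /andP[].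
case/mapP => i; rewrite mem_filter => /andP[yi0 _] -> {x} imin.
have yint j : val_ge w 0 ((y i)^-1 * y j).
  have [->|yj0] := eqVneq (y j) 0; first by rewrite mulr0; apply: (val_ge0 hw).
  by rewrite mulrC; apply: imin; apply: map_f; rewrite mem_filter yj0 mem_enum.
have /choice[u uE] j := residue hw (yint j).
have ui0 : u i != 0.
  apply/eqP => ui0; have := uE i; rewrite mulVf // ui0 rmorph0 subr0.
  by rewrite /val_ge (val1 hw).
have red : reduces_to w (norm_poly (fun j => (y i)^-1 * y j)) (\det (\sum_j (u j)%:P *: B j)).
  apply: (reduces_to_det hw) => a b; rewrite !summxE; apply: (reduces_to_sum hw) => j.
  rewrite !mxE; apply: (reduces_toM hw); last exact: reduces_to_map.
  move=> l; rewrite !coefC; case: (l == 0)%N; first exact: uE.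
  by rewrite rmorph0 subrr; apply: (val_ge0 hw).
have := reduces_to_neq0 hw red (B_regular (ex_intro _ i ui0)).
by rewrite norm_polyZ mulf_eq0 => /norP[].
Qed.

Lemma norm_poly_bounded (s : seq (K -> \bar int)) d y :
  (forall j, bounded_by (multiple d s) (y j)) ->
  forall i, bounded_by (multiple (n * d) s) (norm_poly y)`_i.
Proof.
move=> yb.
pose Pbnd e (p : {poly K}) := forall i, bounded_by (multiple e s) p`_i.
have PbndM e e' p q : Pbnd e p -> Pbnd e' q -> Pbnd (e + e')%N (p * q).
  by move=> hp hq i; rewrite coefM; apply: bounded_by_sum => j _; apply: bounded_byM.
have Pbnd_map e q : Pbnd e (map_poly (const_in K) q).
  by move=> i; rewrite coef_map; apply: bounded_by_const.
have entry a b : Pbnd d ((\sum_j (y j)%:P *: map_mx (map_poly (const_in K)) (B j)) a b).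
  rewrite summxE => i; rewrite coef_sum; apply: bounded_by_sum => j _; rewrite !mxE coefCM.
  by rewrite -[d]addn0; apply: bounded_byM => //; apply: Pbnd_map.
move=> i; rewrite coef_sum; apply: bounded_by_sum => sigma _.
move: i; rewrite -/(Pbnd _ _) -[(n * d)%N]add0n; apply: (PbndM).
  by rewrite -(rmorph_sign (map_poly (const_in K))); apply: Pbnd_map.
have factors (r : seq 'I_n) (F : 'I_n -> {poly K}) : (forall i, Pbnd d (F i)) ->
    Pbnd (size r * d)%N (\prod_(i <- r) F i).
  move=> hF; elim: r => [|i r IH]; last by rewrite big_cons /= mulSn; apply: PbndM.
  by rewrite big_nil -(rmorph1 (map_poly (const_in K))); apply: Pbnd_map.
have enum_size : size (index_enum 'I_n) = n.
  by rewrite -[RHS]card_ord cardT enumT /index_enum unlock.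
by rewrite -{1}enum_size; apply: factors => i; apply: entry.
Qed.

(** The equation makes [t] a root of [norm_poly y], so that
[degree_le_of_root] applies. *)
Lemma linear_equation_height (s : seq (K -> \bar int)) d y :
  (forall j, bounded_by (multiple d s) (y j)) -> (exists j, y j != 0) ->
  \det (\sum_j y j *: map_mx (poly_in K) (B j)) = 0 ->
  (\dim {:K} <= n * d * size s)%N.
Proof.
move=> yb y0 det0; rewrite -size_multiple.
apply: (degree_le_of_root (norm_poly_neq0 y0)); last exact: norm_poly_bounded.
rewrite /root -[X in X == 0]/(horner_eval (tvar K) _) /norm_poly -det_map_mx -det0.
apply/eqP; congr (\det _); rewrite map_mx_sum; apply: eq_bigr => j _.
apply/matrixP => a b; rewrite !mxE poly_inE.
by apply: etrans (hornerM _ _ _) _; rewrite hornerC.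
Qed.

End LinearEquation.

(** * Heights *)

Import -(notations) mpoly.

Section HeightDivisor.
Variables (k : closedFieldType) (K : fieldExtType (ratfun k)) (n : nat) (x : 'I_n -> K).

Lemma local_height_bound w : places w ->
  0 <= local_height w x /\ forall i, val_ge w (- local_height w x) (x i).
Proof.
move=> [hw _]; rewrite /local_height; set M := \big[_/_]_(i < n) _.
have M0 : (0 <= M)%E by apply: bigmax_ge_id.
have Moo : (M < +oo)%E.
  apply/bigmax_ltP; split=> // i _; have [->|xi0] := eqVneq (x i) 0.
    by rewrite (valuation0 hw).
  by have [m ->] := val_fin hw xi0; rewrite -EFinN ltry.
have [m ME] : exists m : int, M = m%:E.
  by move: M0 Moo; case: M => // m _ _; exists m.
rewrite ME /=; split; first by rewrite ME lee_fin in M0.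
by move=> i; rewrite /val_ge EFinN leeNl -ME; apply: le_bigmax.
Qed.

(** Each place in [s] contributes to the sum at some place of [k(t)] below it. *)
Lemma finite_sum_le_height (R : realType) (s : seq (K -> \bar int)) :
  uniq s -> (forall w, w \in s -> places w) ->
  ((\sum_(w <- s) (local_height w x)%:~R : R)%:E <=
   \esum_(v in @ratfun_places k) \esum_(w in @places k K `&` [set w | lies_above w v])
      ((local_height w x)%:~R)%:E)%E.
Proof.
move=> us ps.
have lh0 w : places w -> (0 <= ((local_height w x)%:~R : R)%:E)%E.
  by move=> /local_height_bound[h _]; rewrite lee_fin ler0z.
rewrite esum_esum; last by move=> v w _ [/lh0].
have /choice[f fP] (w : K -> \bar int) : exists v, places w -> ratfun_places v /\ lies_above w v.
  have [[_ [v pv wv]]|nw] := pselect (places w); first by exists v.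
  by exists (fun=> 0%E).
apply: le_ereal_sup_tmp; pose s2 := [seq (f w, w) | w <- s].
have us2 : uniq s2 by rewrite map_inj_uniq // => w w' [_].
exists (\sum_(p \in [set` s2]) ((local_height p.2 x)%:~R : R)%:E)%E; last first.
  by rewrite -fsbig_seq // /s2 big_map /= sumEFin.
exists [set` s2] => //; split; first exact: finite_seq.
move=> _ /= /mapP[w /ps pw ->] /=; have [pv wv] := fP w pw.
by split.
Qed.

(** The divisor of poles of the coordinates. Its support is finite because each
place in it contributes at least [1] to the height: a longest list of such
places contains all of them. *)
Lemma height_divisor (R : realType) (B : R) :
  (\esum_(v in @ratfun_places k) \esum_(w in @places k K `&` [set w | lies_above w v])
      ((local_height w x)%:~R)%:E <= B%:E)%E ->
  exists2 s : seq (K -> \bar int), (size s)%:R <= B & forall i, bounded_by s (x i).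
Proof.
move=> hB.
have sumB s : uniq s -> (forall w, w \in s -> places w) ->
    (\sum_(w <- s) (local_height w x)%:~R : R) <= B.
  by move=> us ps; rewrite -lee_fin; apply: le_trans hB; apply: finite_sum_le_height.
pose good s := [/\ uniq s, (forall w, w \in s -> places w) &
  forall w, w \in s -> 1 <= local_height w x].
have good_size s : good s -> (size s <= Num.bound B)%N.
  move=> [us ps hs]; have B0 : 0 <= B by have := sumB [::] isT; rewrite big_nil; apply.
  rewrite ltnW // -(ltr_nat R); apply: le_lt_trans (archi_boundP B0).
  apply: le_trans (sumB s us ps); rewrite -sum1_size natr_sum big_seq [leRHS]big_seq.
  by apply: ler_sum => w /hs h; rewrite -[1%:R]/(1%:~R) ler_int.
pose Q m := `[< exists2 s, good s & size s = m >].
have exQ : exists m, Q m by exists 0%N; apply/asboolP; exists [::].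
have ubQ m : Q m -> (m <= Num.bound B)%N by move=> /asboolP[s /good_size + <-].
case: (ex_maxnP exQ ubQ) => m /asboolP[s [us ps hs] sm] smax.
exists (flatten [seq nseq `|local_height w x|%N w | w <- s]).
  apply: le_trans (sumB s us ps); rewrite size_flatten /shape -map_comp sumnE big_map natr_sum.
  rewrite big_seq [leRHS]big_seq; apply: ler_sum => w ws /=; rewrite size_nseq.
  have [h _] := local_height_bound (ps w ws).
  by rewrite -[X in X <= _]/(`|local_height w x|%N%:~R) gez0_abs.
move=> i w pw; have [h0 h] := local_height_bound pw.
apply: (val_geW _ (h i)); rewrite lerN2 count_flatten -map_comp sumnE big_map.
have [ws|ws] := boolP (w \in s).
  rewrite (bigD1_seq w) //= count_nseq /= eqxx mul1n PoszD gez0_abs // lerDl.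
  by rewrite lez_nat.
suff : local_height w x < 1 by lia.
rewrite ltNge; apply/negP => h1; have : Q m.+1; last by move=> /smax; rewrite ltnn.
apply/asboolP; exists (w :: s); last by rewrite /= sm.
split; first by rewrite /= ws.
  by move=> w'; rewrite inE => /orP[/eqP->|/ps].
by move=> w'; rewrite inE => /orP[/eqP->|/hs].
Qed.

Definition total_degree (p : mpoly.mpoly n k) : nat :=
  \max_(m <- mpoly.msupp p) mpoly.mdeg m.

(** A polynomial of degree [d] over [k] multiplies pole orders at most by [d]. *)
Lemma bounded_by_mmap (s : seq (K -> \bar int)) (d : nat) (p : mpoly.mpoly n k) :
  (forall i, bounded_by s (x i)) -> (total_degree p <= d)%N ->
  bounded_by (multiple d s) (mpoly.mmap (const_in K) x p).
Proof.
move=> xs pd; rewrite /mpoly.mmap big_seq; apply: bounded_by_sum => m mp.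
rewrite -[d]add0n; apply: bounded_byM; first exact: bounded_by_const.
apply: (@bounded_by_multipleW _ _ _ (mpoly.mdeg m)).
  apply: leq_trans pd; rewrite /total_degree.
  exact: (@leq_bigmax_seq _ _ xpredT (fun m => mpoly.mdeg m) m mp isT).
rewrite mpoly.mdegE /mpoly.mmap1.
elim: (index_enum _) => [|i r IH]; last first.
  rewrite !big_cons; apply: bounded_byM => //.
  by rewrite -[X in multiple X]mul1n; apply/bounded_byX/bounded_by_multiple1.
by rewrite !big_nil; move=> w [hw _]; apply: val_ge1.
Qed.

End HeightDivisor.

Lemma meval_map_mpoly n (F L : fieldType) (phi : {rmorphism F -> L}) (P : 'I_n -> L)
    (p : mpoly.mpoly n F) :
  mpoly.meval P (mpoly.map_mpoly phi p) = mpoly.mmap phi P p.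
Proof.
rewrite /mpoly.map_mpoly /mpoly.mmap rmorph_sum; apply: eq_bigr => m _.
rewrite rmorphM /= mpoly.mevalC; congr (_ * _).
rewrite /mpoly.mmap1 rmorph_prod; apply: eq_bigr => i _.
by rewrite rmorphXn /= mpoly.mevalXU.
Qed.

(** * Small points *)

Lemma mmap_rmorph (n : nat) (F E E' : fieldType) (f : {rmorphism F -> E}) (g : {rmorphism E -> E'})
    (h : F -> E') (x : 'I_n -> E) (y : 'I_n -> E') (p : mpoly n F) :
  (forall a, g (f a) = h a) -> (forall i, g (x i) = y i) -> g (mmap f x p) = mmap h y p.
Proof.
move=> gf gx; rewrite /mmap rmorph_sum; apply: eq_bigr => m _.
rewrite rmorphM gf /mmap1 rmorph_prod; congr (_ * _).
by apply: eq_bigr => i _; rewrite rmorphXn /= gx.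
Qed.

Section AlgebraicClosure.
Variables (R : realType) (k L : closedFieldType) (iota : {rmorphism ratfun k -> L}).
Hypothesis iota_alg : forall z : L, algebraicOver iota z.
Local Notation phi := (const_embedding iota).

Definition const_independent m (c : 'I_m -> L) : Prop :=
  forall u : 'I_m -> k, (exists j, u j != 0) -> \sum_j phi (u j) * c j != 0.

(** On the span of a vector [b] as in [stable_basis] the matrix
[sum_j u_j B_j] acts as multiplication by a nonzero scalar; since the entries
of [b] are independent it is invertible. *)
Lemma regular_matrices m (c : 'I_m -> L) : const_independent c ->
  exists n (b : 'cV[L]_n) (B : 'I_m -> 'M[{poly k}]_n) (q : {poly k}),
  [/\ b != 0,
      forall j, map_mx (fun p => iota p%:F) (B j) *m b = (iota q%:F * c j) *: b &
      forall u : 'I_m -> k, (exists j, u j != 0) -> \det (\sum_j (u j)%:P *: B j) != 0].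
Proof.
move=> cind; have [n [b [A [b0 bE bfree]]]] := stable_basis iota_alg c.
have [q q0 [g gE]] := common_denominator (fun jil : 'I_m * 'I_n * 'I_n => A jil.1.1 jil.1.2 jil.2).
pose B j : 'M[{poly k}]_n := \matrix_(i, l) g (j, i, l).
have BE j : map_mx (fun p => iota p%:F) (B j) *m b = (iota q%:F * c j) *: b.
  rewrite -scalerA -bE scalemxAl; congr (_ *m _); apply/matrixP => i l.
  by rewrite !mxE -(gE (j, i, l)); apply: rmorphM.
exists n, b, B, q; split=> // u u0; apply/negP => /eqP det0.
pose M := map_mx (@tofrac {poly k}) (\sum_j (u j)%:P *: B j).
have /eqP/det0P[v v0 vM] : \det M = 0 by rewrite /M det_map_mx det0 rmorph0.
have Mb : map_mx iota M *m b = (iota q%:F * \sum_j phi (u j) * c j) *: b.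
  rewrite mulr_sumr scaler_suml /M !map_mx_sum mulmx_suml; apply: eq_bigr => j _.
  rewrite mulrCA -scalerA -BE scalemxAl; congr (_ *m _); apply/matrixP => i l.
  rewrite !mxE.
  exact: etrans (congr1 iota (tofracM _ _)) (rmorphM iota _ _).
move/eqP: v0; apply; apply: bfree.
have := congr1 (fun N => map_mx iota N *m b) vM.
rewrite map_mxM -mulmxA Mb -scalemxAr map_mx0 mul0mx => /eqP.
by rewrite scaler_eq0 mulf_eq0 fmorph_eq0 tofrac_eq0 (negPf q0) (negPf (cind u u0)) => /eqP.
Qed.

Lemma small_points_in_field n (P : 'I_n -> L) (eps : R) : small_points iota eps P ->
  exists (K : fieldExtType (ratfun k)) (j : {rmorphism K -> L}) (x : 'I_n -> K)
    (s : seq (K -> \bar int)),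
  [/\ forall a : ratfun k, j a%:A = iota a, forall i, j (x i) = P i,
      forall i, bounded_by s (x i) & (size s)%:R <= (\dim {:K})%:R * eps].
Proof.
rewrite /small_points /= /height.
case: xgetP => [r _ [K [j [x [jiota jx ->]]]] hr|_]; last by rewrite leye_eq.
have N0 : (0 : R) < (\dim {:K})%:R by rewrite ltr0n adim_gt0.
move: hr; rewrite /height_in lee_pdivrMl // -EFinM => /height_divisor[s sN xs].
by exists K, j, x, s.
Qed.

(** Let [N] be the size of the matrices of [regular_matrices] and [D] the degree
of a field that contains the coordinates of [P]. The values [F_j(P)] have at most
[d * D * h(P)] poles; by [linear_equation_height], if they are not all zero, they
have at least [D / N] poles. *)
Lemma small_linear_relation n m (c : 'I_m -> L) (F : 'I_m -> mpoly n k) :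
  const_independent c -> exists2 eps : R, 0 < eps &
    forall P : 'I_n -> L, \sum_j c j * mmap phi P (F j) = 0 -> small_points iota eps P ->
    forall j, mmap phi P (F j) = 0.
Proof.
move=> /regular_matrices[N [b [B [q [b0 bE Breg]]]]].
pose d := (\max_j total_degree (F j))%N; pose M := (N * d)%N.
exists (M.+1%:R^-1); first by rewrite invr_gt0 ltr0n.
move=> P sumP /small_points_in_field[K [j [x [s [jiota jx xs sM]]]]].
pose y l := mmap (const_in K) x (F l).
have jy l : j (y l) = mmap phi P (F l) by apply: mmap_rmorph => // a; apply: jiota.
suff y0 l : y l = 0 by move=> l; rewrite -jy y0 rmorph0.
apply: contrapT => /eqP yl0.
have yb l' : bounded_by (multiple d s) (y l').
  by apply: bounded_by_mmap => //; apply: leq_bigmax.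
have det0 : \det (\sum_l y l *: map_mx (poly_in K) (B l)) = 0.
  set D := \sum_l _; apply: (fmorph_inj j); rewrite -det_map_mx rmorph0.
  have Db : map_mx j D *m b = 0.
    rewrite /D map_mx_sum mulmx_suml -[RHS](scale0r b) -(mulr0 (iota q%:F)) -sumP.
    rewrite mulr_sumr scaler_suml; apply: eq_bigr => l' _.
    rewrite mulrA -jy mulrC -scalerA -bE scalemxAl; congr (_ *m _); apply/matrixP => a a'.
    by rewrite !mxE; apply: etrans (rmorphM j _ _) _; congr (_ * _); apply: jiota.
  apply/eqP; apply: contraT => detD; move: Db => /(congr1 (mulmx (invmx (map_mx j D)))).
  by rewrite mulKmx ?mulmx0 ?unitmxE ?unitfE // => /eqP; rewrite (negPf b0).
have := linear_equation_height Breg yb (ex_intro _ l yl0) det0.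
rewrite -/M leqNgt => /negP; apply; rewrite -(ltr_nat R) natrM.
have N0 : (0 : R) < (\dim {:K})%:R by rewrite ltr0n adim_gt0.
apply: (@le_lt_trans _ _ (M%:R * ((\dim {:K})%:R * M.+1%:R^-1))).
  by rewrite ler_wpM2l.
by rewrite mulrCA gtr_pMr // ltr_pdivrMr ?ltr0n // mul1r ltr_nat.
Qed.

End AlgebraicClosure.

Theorem theorem1p4 (R : realType) (k : closedFieldType)
    (L : closedFieldType) (iota : {rmorphism ratfun k -> L})
    (iota_alg : forall z : L, algebraicOver iota z)
    (n : nat) (n_gt0 : (0 < n)%N)
    (V : set ('I_n -> L)) (V_closed : zariski_closed V)
    (V_small : forall eps : R, 0 < eps ->
       zariski_dense_in V (V `&` small_points iota eps)) :
  defined_over (const_embedding iota) V.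
Proof.
set phi := const_embedding iota.
pose T : set (mpoly n k) := [set g | forall P, V P -> mmap phi P g = 0].
have [S VS] := V_closed; exists T; apply/seteqP; split=> [P VP _ [g Tg <-]|P PT].
  by rewrite meval_map_mpoly; apply: Tg.
have {}PT g : T g -> mmap phi P g = 0.
  by move=> Tg; rewrite -meval_map_mpoly; apply: PT; exists g.
(* By induction on the length, coefficients [c_j] that are dependent over [k]
are eliminated. *)
have vanish m (c : 'I_m -> L) (F : 'I_m -> mpoly n k) :
    (forall Q, V Q -> \sum_j c j * mmap phi Q (F j) = 0) -> \sum_j c j * mmap phi P (F j) = 0.
  elim: m c F => [|m IH] c F cF; first by rewrite big_ord0.
  have [cind|] := pselect (const_independent iota c).
    have [eps eps0 small] := @small_linear_relation R _ _ _ iota_alg n _ c F cind.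
    have [_ dense] := V_small eps eps0.
    apply: big1 => j _; rewrite PT ?mulr0 // => Q VQ.
    rewrite -meval_map_mpoly; apply: (dense (zero_locus [set map_mpoly phi (F j)])) => //.
      by exists [set map_mpoly phi (F j)].
    move=> Q' [VQ' sQ'] _ ->; rewrite meval_map_mpoly.
    exact: small (cF Q' VQ') sQ' j.
  move=> /existsNP[u /not_implyP[[j0 uj0] /negP]]; rewrite negbK => /eqP.
  rewrite (bigD1_ord j0) //= => /eqP; rewrite addr_eq0 => /eqP uE.
  have cj0 : c j0 = - \sum_j phi (u (lift j0 j) / u j0) * c (lift j0 j).
    have phi0 : phi (u j0) != 0 by rewrite fmorph_eq0.
    apply: (mulfI phi0); rewrite uE mulrN mulr_sumr; congr (- _).
    by apply: eq_bigr => j _; rewrite mulrA -rmorphM mulrCA divff // mulr1.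
  pose F' j := F (lift j0 j) - (u (lift j0 j) / u j0) *: F j0.
  have reduce Q : \sum_j c j * mmap phi Q (F j) =
      \sum_j c (lift j0 j) * mmap phi Q (F' j).
    rewrite (bigD1_ord j0) //= cj0 mulNr mulr_suml -sumrN -big_split /=.
    apply: eq_bigr => j _; rewrite mmapB mmapZ mulrBr addrC; congr (_ - _).
    by rewrite mulrCA mulrA.
  by rewrite reduce; apply: IH => Q VQ; rewrite -reduce; apply: cF.
rewrite VS => f Sf; pose ms := msupp f.
have fE Q : meval Q f = \sum_(j < size ms)
    mcoeff (tnth (in_tuple ms) j) f * mmap phi Q (mpolyX k (tnth (in_tuple ms) j)).
  rewrite /meval /mmap big_tnth; apply: eq_bigr => j _; congr (_ * _).
  by rewrite -[RHS]/(mmap phi Q _) mmapX.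
rewrite fE; apply: vanish => Q VQ; rewrite -fE.
by move: VQ; rewrite VS; apply.
Qed.
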